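(* Let $\omega=-i\left(\frac{dw\wedge d\overline{w}}{(w_2)^2}+w_2\,dz\wedge d\overline{z}\right)$ be the locally conformally Kähler (l.c.k.) structure on the Inoue surface $S_M$, and let $L$ be the corresponding flat line bundle to $\omega$. Let $\{L_s\}$ be the deformations of flat line bundles with $L_0=L$ given by the $d$-closed $1$-forms $\{s\eta\}$, where $\eta$ is a $d$-closed $1$-form with $[\eta]\neq0\in H^1(S_M,\mathbb{R})$. Then $S_M$ does not admit a smooth family of l.c.k. structures $\{\omega_s\}$ such that $L_s$ is the corresponding flat line bundle to $\omega_s$ (for all small real $s$).
   Context: An l.c.k. structure on a complex manifold is the fundamental $2$-form $\omega$ of a Hermitian metric such that $d\omega=\eta'\wedge\omega$ for some $d$-closed real $1$-form $\eta'$ (the Lee form). (The sign convention for fundamental forms is such that the $\omega$ in the claim is positive.) The corresponding flat line bundle to $\omega$ is the real flat line bundle with locally constant transition functions $e^{-\lambda_{ij}}$ where, on a suitable open cover $\{U_i\}$, $\eta'|_{U_i}=df_i$ and $\lambda_{ij}=f_i-f_j$ is constant on $U_i\cap U_j$ (flat line bundles are considered up to isomorphism). With $d_L$ the induced exterior derivative on $L$-valued forms, the deformation $L_s$ given by $s\eta$ is the flat line bundle whose flat sections are the sections $\sigma$ of $L$ with $(d_L+s\eta)\sigma=0$. Inoue surface $S_M$: let $\mathbb{H}$ be the upper half plane with coordinate $w=w_1+\sqrt{-1}\,w_2$, and let $z$ be the coordinate of $\mathbb{C}$. Let $M\in SL(3,\mathbb{Z})$ have a real eigenvalue $\alpha>1$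 and two complex conjugate eigenvalues $\beta\neq\overline{\beta}$; let $(a_1,a_2,a_3)$ be a real eigenvector for $\alpha$ and $(b_1,b_2,b_3)$ an eigenvector for $\beta$. Then $S_M=(\mathbb{H}\times\mathbb{C})/G_M$, where $G_M$ is generated by $\phi_0(w,z)=(\alpha w,\beta z)$ and $\phi_i(w,z)=(w+a_i,z+b_i)$, $i=1,2,3$; $G_M$ acts freely and properly discontinuously with compact quotient. The form $\omega$ is $G_M$-invariant and has Lee form $\frac{dw_2}{w_2}$. *)

(* Defs.v *)
From HB Require Import structures.
From mathcomp Require Import all_boot all_order all_algebra.
From mathcomp Require Import all_classical all_reals all_analysis.
From mathcomp Require Import complex ring.
Import Order.TTheory GRing.Theory Num.Theory.
Import numFieldNormedType.Exports.

Set Implicit Arguments.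
Unset Strict Implicit.
Unset Printing Implicit Defensive.

Local Open Scope classical_set_scope.
Local Open Scope ring_scope.

(* C^2 as a real normed space, with coordinates ((w_1, w_2), (z_1, z_2)).     *)
(* Being a real vector space, it is also the tangent space at each point.     *)
Notation C2 R := ((R * R) * (R * R))%type.

Definition wcoord (R : realType) (x : C2 R) : R[i] := Complex x.1.1 x.1.2.
Definition zcoord (R : realType) (x : C2 R) : R[i] := Complex x.2.1 x.2.2.
Definition mkC2 (R : realType) (w z : R[i]) : C2 R :=
  ((complex.Re w, complex.Im w), (complex.Re z, complex.Im z)).

Definition Jmul (R : realType) (u : C2 R) : C2 R :=
  mkC2 ('i%C * wcoord u) ('i%C * zcoord u).

Definition HxC (R : realType) : set (C2 R) := [set x | 0 < x.1.2].

(* C^oo: every iterated directional derivative is (Frechet-)differentiable;   *)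
(* meaningful for open D only.                                                *)
Definition smooth_on (R : realType) (V : normedModType R) (D : set V)
    (f : V -> R) : Prop :=
  forall (vs : seq V) (x : V), D x ->
    differentiable (foldr (fun v h => 'D_v h : V -> R) f vs) x.

Inductive generated (T : Type) (S : set (T -> T)) : (T -> T) -> Prop :=
| gen_mem f : S f -> generated S f
| gen_id : generated S id
| gen_comp f g : generated S f -> generated S g -> generated S (f \o g)
| gen_inv f g : generated S f -> cancel f g -> cancel g f -> generated S g.

Definition phi0 (R : realType) (alpha : R) (beta : R[i]) (x : C2 R) : C2 R :=
  mkC2 (alpha%:C%C * wcoord x) (beta * zcoord x).
Definition phi (R : realType) (a : 'cV[R]_3) (b : 'cV[R[i]]_3) (i : 'I_3)
    (x : C2 R) : C2 R :=
  mkC2 (wcoord x + (a i ord0)%:C%C) (zcoord x + b i ord0).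

(* G_M, acting on all of C^2 by the same formulas; it preserves HxC.          *)
Definition inoue_group (R : realType) (alpha : R) (beta : R[i])
    (a : 'cV[R]_3) (b : 'cV[R[i]]_3) : set (C2 R -> C2 R) :=
  generated [set f | f = phi0 alpha beta \/ exists i, f = phi a b i].

(* Below, G is a group of transformations such as inoue_group.  The points of *)
(* HxC / G are the G-orbits in HxC, and orbit_of G is the projection.  A      *)
(* function on HxC / G is a function on orbits, a tensor field on HxC / G is  *)
(* represented by its pull-back, a G-invariant tensor field on HxC.  Values   *)
(* outside of quot G, resp. HxC, are irrelevant.                              *)
Definition orbit_of (R : realType) (G : set (C2 R -> C2 R)) (x : C2 R) :
    set (C2 R) :=
  [set y | exists2 g, G g & y = g x].

Definition quot (R : realType) (G : set (C2 R -> C2 R)) : set (set (C2 R)) :=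
  orbit_of G @` @HxC R.

Definition quot_open (R : realType) (G : set (C2 R -> C2 R))
    (W : set (set (C2 R))) : Prop :=
  W `<=` quot G /\ open (@HxC R `&` orbit_of G @^-1` W).

Definition quot_smooth (R : realType) (G : set (C2 R -> C2 R))
    (W : set (set (C2 R))) (f : set (C2 R) -> R) : Prop :=
  smooth_on (@HxC R `&` orbit_of G @^-1` W) (f \o orbit_of G).

(* df evaluated at the point orbit_of G x and the tangent vector v *)
Definition quot_d (R : realType) (G : set (C2 R -> C2 R))
    (f : set (C2 R) -> R) (x v : C2 R) : R :=
  'D_v (f \o orbit_of G) x.

Definition locally_constant (R : realType) (G : set (C2 R -> C2 R))
    (W : set (set (C2 R))) (f : set (C2 R) -> R) : Prop :=
  forall p, W p -> exists N,
    [/\ quot_open G N, N p & forall q, N q -> W q -> f q = f p].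

(* Covariant tensor fields: the first argument is the point.                  *)
Definition tensor1 (R : realType) := C2 R -> C2 R -> R.
Definition tensor2 (R : realType) := C2 R -> C2 R -> C2 R -> R.

Definition quot_form1 (R : realType) (G : set (C2 R -> C2 R))
    (theta : tensor1 R) : Prop :=
  [/\ forall u, smooth_on (@HxC R) (fun x => theta x u),
      forall x, HxC x -> forall k u v,
        theta x (k *: u + v) = k * theta x u + theta x v
    & forall g, G g -> forall x, HxC x -> forall u,
        theta (g x) ('D_u g x) = theta x u].

(* Exterior derivatives, evaluated on constant vector fields (which commute). *)
Definition ext_d1 (R : realType) (theta : tensor1 R) (x u v : C2 R) : R :=
  'D_u (fun y => theta y v) x - 'D_v (fun y => theta y u) x.
Definition ext_d2 (R : realType) (omega : tensor2 R) (x u v t : C2 R) : R :=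
  'D_u (fun y => omega y v t) x - 'D_v (fun y => omega y u t) x
  + 'D_t (fun y => omega y u v) x.

Definition wedge12 (R : realType) (theta : tensor1 R) (omega : tensor2 R)
    (x u v t : C2 R) : R :=
  theta x u * omega x v t - theta x v * omega x u t + theta x t * omega x u v.

Definition closed_form1 (R : realType) (G : set (C2 R -> C2 R))
    (theta : tensor1 R) : Prop :=
  quot_form1 G theta /\ forall x, HxC x -> forall u v, ext_d1 theta x u v = 0.

(* vanishing of the class of theta in H^1(HxC / G, R) *)
Definition exact_form1 (R : realType) (G : set (C2 R -> C2 R))
    (theta : tensor1 R) : Prop :=
  exists2 f, quot_smooth G (quot G) f &
    forall x, HxC x -> forall v, quot_d G f x v = theta x v.

Definition hermitian_metric (R : realType) (G : set (C2 R -> C2 R))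
    (h : tensor2 R) : Prop :=
  [/\ forall u v, smooth_on (@HxC R) (fun x => h x u v),
      forall x, HxC x -> [/\
        forall k u v t, h x (k *: u + v) t = k * h x u t + h x v t,
        forall u v, h x u v = h x v u,
        forall u, u != 0 -> 0 < h x u u
      & forall u v, h x (Jmul u) (Jmul v) = h x u v]
    & forall g, G g -> forall x, HxC x -> forall u v,
        h (g x) ('D_u g x) ('D_v g x) = h x u v].

(* The sign convention is h(u, Jv), not h(Ju, v): it makes inoue_omega below  *)
(* positive, see inoue_omegaE.                                                *)
Definition fundamental_form (R : realType) (h : tensor2 R) : tensor2 R :=
  fun x u v => h x u (Jmul v).

Definition lee_form (R : realType) (G : set (C2 R -> C2 R))
    (omega : tensor2 R) (theta : tensor1 R) : Prop :=
  closed_form1 G theta /\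
  forall x, HxC x -> forall u v t,
    ext_d2 omega x u v t = wedge12 theta omega x u v t.

Definition lck (R : realType) (G : set (C2 R -> C2 R))
    (omega : tensor2 R) : Prop :=
  (exists2 h, hermitian_metric G h &
     forall x, HxC x -> forall u v, omega x u v = fundamental_form h x u v) /\
  exists theta, lee_form G omega theta.

(* A real line bundle given by transition functions: in the trivializations   *)
(* over bcover i and bcover j, a section satisfies                            *)
(* sigma i = btrans i j * sigma j.                                            *)
Record bundle (R : realType) := Bundle {
  bidx : Type;
  bcover : bidx -> set (set (C2 R));
  btrans : bidx -> bidx -> set (C2 R) -> R }.

Definition open_cover (R : realType) (G : set (C2 R -> C2 R)) (I : Type)
    (U : I -> set (set (C2 R))) : Prop :=
  (forall i, quot_open G (U i)) /\ forall p, quot G p -> exists i, U i p.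

Definition flat_bundle (R : realType) (G : set (C2 R -> C2 R))
    (L : bundle R) : Prop :=
  let U := @bcover R L in let g := @btrans R L in
  [/\ open_cover G U,
      forall i j, locally_constant G (U i `&` U j) (g i j),
      forall i j p, U i p -> U j p -> g i j p != 0
    & forall i j k p, U i p -> U j p -> U k p -> g i j p * g j k p = g i k p].

(* t is an isomorphism from L' to L, written in trivializations:              *)
(* sigma' is mapped to sigma with sigma i = t i a * sigma' a.                 *)
Definition bundle_iso (R : realType) (L' L : bundle R)
    (t : bidx L -> bidx L' -> set (C2 R) -> R) : Prop :=
  [/\ forall i a p, bcover i p -> bcover a p -> t i a p != 0,
      forall i j a p, bcover i p -> bcover j p -> bcover a p ->
        btrans i j p * t j a p = t i a p
    & forall i a b p, bcover i p -> bcover a p -> bcover b p ->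
        t i a p * btrans a b p = t i b p].

Definition flat_iso (R : realType) (G : set (C2 R -> C2 R))
    (L' L : bundle R) : Prop :=
  exists2 t, bundle_iso (L' := L') (L := L) t &
    forall i a, locally_constant G (bcover i `&` bcover a) (t i a).

Definition bundle_section (R : realType) (G : set (C2 R -> C2 R))
    (L : bundle R) (W : set (set (C2 R)))
    (sigma : bidx L -> set (C2 R) -> R) : Prop :=
  (forall i, quot_smooth G (W `&` bcover i) (sigma i)) /\
  (forall i j p, W p -> bcover i p -> bcover j p ->
     sigma i p = btrans i j p * sigma j p).

Definition flat_section (R : realType) (G : set (C2 R -> C2 R))
    (L : bundle R) (W : set (set (C2 R)))
    (sigma : bidx L -> set (C2 R) -> R) : Prop :=
  forall i, locally_constant G (W `&` bcover i) (sigma i).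

(* (d_L + theta) sigma = 0 on W; in a flat trivialization d_L is d *)
Definition twisted_closed (R : realType) (G : set (C2 R -> C2 R))
    (L : bundle R) (theta : tensor1 R) (W : set (set (C2 R)))
    (sigma : bidx L -> set (C2 R) -> R) : Prop :=
  forall i x, HxC x -> (W `&` bcover i) (orbit_of G x) ->
    forall v, quot_d G (sigma i) x v + theta x v * sigma i (orbit_of G x) = 0.

(* L' is L as a smooth line bundle (through some t), with the new flat        *)
(* structure whose flat local sections are the solutions of                   *)
(* (d_L + theta) sigma = 0.                                                   *)
Definition deformation (R : realType) (G : set (C2 R -> C2 R))
    (L : bundle R) (theta : tensor1 R) (L' : bundle R) : Prop :=
  flat_bundle G L' /\
  exists t, [/\ bundle_iso (L' := L') (L := L) t,
    forall i a, quot_smooth G (bcover i `&` bcover a) (t i a)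
  & forall W sigma' sigma, quot_open G W ->
      bundle_section G W sigma' -> bundle_section G W sigma ->
      (forall i a p, W p -> bcover i p -> bcover a p ->
         sigma i p = t i a p * sigma' a p) ->
      flat_section G W sigma' <-> twisted_closed G theta W sigma].

Definition corresponding_bundle (R : realType) (G : set (C2 R -> C2 R))
    (omega : tensor2 R) (L : bundle R) : Prop :=
  exists theta, lee_form G omega theta /\
  exists (I : Type) (U : I -> set (set (C2 R))) (f : I -> set (C2 R) -> R),
    [/\ open_cover G U,
        forall i, quot_smooth G (U i) (f i),
        forall i x, HxC x -> U i (orbit_of G x) ->
          forall v, quot_d G (f i) x v = theta x v,
        forall i j, exists c, forall p, U i p -> U j p -> f i p - f j p = c
      & flat_iso G (Bundle U (fun i j p => expR (- (f i p - f j p)))) L].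

(* joint smoothness in the parameter and the point *)
Definition smooth_family (R : realType) (eps : R) (omegas : R -> tensor2 R) :
    Prop :=
  forall u v : C2 R,
    smooth_on [set y : R * C2 R | `|y.1| < eps /\ HxC y.2]
      (fun y => omegas y.1 y.2 u v).

Definition wedge11C (R : realType) (p q : C2 R -> R[i]) (u v : C2 R) : R[i] :=
  p u * q v - p v * q u.

(* wcoord and zcoord are R-linear, hence are their own differentials dw, dz.  *)
Definition inoue_omegaC (R : realType) (x u v : C2 R) : R[i] :=
  - 'i%C *
  (wedge11C (@wcoord R) (fun t => conjc (wcoord t)) u v
     / ((complex.Im (wcoord x)) ^+ 2)%:C%C
   + (complex.Im (wcoord x))%:C%C *
     wedge11C (@zcoord R) (fun t => conjc (zcoord t)) u v).

Definition inoue_omega (R : realType) : tensor2 R :=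
  fun x u v => complex.Re (inoue_omegaC x u v).

Lemma complex_realV (R : realType) (r : R) : (r%:C%C)^-1 = (r^-1)%:C%C.
Proof. by rewrite fmorphV. Qed.

Lemma inoue_omegaC_real (R : realType) (x u v : C2 R) :
  ((inoue_omega x u v)%:C)%C = inoue_omegaC x u v.
Proof.
rewrite /inoue_omega /inoue_omegaC /wedge11C /wcoord /zcoord !complex_realV /=.
by simpc; congr Complex; ring.
Qed.

Definition inoue_metric (R : realType) : tensor2 R := fun x u v =>
  2 * ((u.1.1 * v.1.1 + u.1.2 * v.1.2) / x.1.2 ^+ 2
       + x.1.2 * (u.2.1 * v.2.1 + u.2.2 * v.2.2)).

Lemma inoue_omegaE (R : realType) (x u v : C2 R) :
  inoue_omega x u v = fundamental_form (@inoue_metric R) x u v.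
Proof.
rewrite /inoue_omega /inoue_omegaC /wedge11C /fundamental_form /inoue_metric.
rewrite /Jmul /mkC2 /wcoord /zcoord !complex_realV /=.
by simpc => /=; ring.
Qed.

(* Main.v *)
Require Import Defs.
From HB Require Import structures.
From mathcomp Require Import all_boot all_order all_algebra.
From mathcomp Require Import all_classical all_reals all_analysis.
From mathcomp Require Import complex ring lra.
Import Order.TTheory GRing.Theory Num.Theory.
Import numFieldNormedType.Exports.
Set Implicit Arguments.
Unset Strict Implicit.
Unset Printing Implicit Defensive.
Local Open Scope classical_set_scope.
Local Open Scope ring_scope.

(** The reason is that the Lee class of an l.c.k. structure on the Inoue surface
    cannot move, whereas a deformation of [L] by [s * eta] would move it.

    Fix one small [s <> 0], let [omega_s] be an l.c.k. structure with Lee form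
    [theta'] and corresponding bundle [Ls s], and let [theta = dw_2 / w_2] be the
    Lee form of the given [omega] ([lee_form_inoue]). The bundle corresponding to
    a Lee form has a nowhere zero global section whose logarithmic covariant
    derivative is minus the Lee form. Comparing these sections of [L] and [Ls s] through the
    smooth isomorphism of the deformation gives a positive function [k0] on the
    surface with [d (ln k0) = theta - theta' - s * eta] ([ratio_potential]), that
    is, an equality of cohomology classes.

    On the half space [eta] has a primitive [E] ([is_derive_primitive]). Because 1
    is not an eigenvalue of [M], it is invariant under the translations of the
    group, and the dilation [phi0] adds a constant [rho] to it
    ([primitive_periods]); if [rho = 0] then [eta] is exact
    ([invariant_primitive_exact]). The function
    [kappa = k0 * expR (s * E) / w_2] satisfies [d kappa = - theta' * kappa], so
    [kappa * omega_s] is a closed form, invariant under the translations, and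
    [phi0] multiplies [kappa] by [expR (s * rho) / alpha].

    The heart of the proof is [kaehler_factor]: the factor by which [phi0]
    multiplies [kappa] must be [alpha^-1]. The slices [w_2 = constant] are
    3-tori modulo translations. Closedness of [kappa * omega_s] writes the
    [w_2]-derivative of its coefficient [f] along the [z]-line as a divergence
    along these tori, so the mean of [f] over the torus does not depend on [w_2]
    ([avgs_sum_derive]). If [phi0] multiplies [kappa] by [c], it multiplies [f] by
    [c * alpha], since [alpha * `|beta| ^+ 2 = 1] ([eigen_product]). By compactness
    [f] lies between two positive constants on the slice [w_2 = 1]
    ([torus_bounds]), hence between their multiples by [(c * alpha) ^+ n] on the
    slice [w_2 = alpha ^+ n]; the mean being constant in [n], [c * alpha = 1].
    Therefore [expR (s * rho) = 1], so [rho = 0] and [eta] is exact, against the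
    hypothesis. *)

(** * Directional calculus and means over the unit interval *)

Section Lines.
Context (R : realType) (V : normedModType R).
Implicit Types (f : V -> R) (x v : V).

Lemma is_derive_line f x v (s : R) (d : R) :
  is_derive (s *: v + x) v f d ->
  is_derive s 1 (fun r : R => f (r *: v + x)) d.
Proof.
move=> [df <-]; have e : (fun h : R => h^-1 *: (f (h *: v + (s *: v + x)) -
    f (s *: v + x))) = (fun h : R => h^-1 *: (f ((h *: 1 + s) *: v + x) -
    f (s *: v + x))).
  by apply/funext => h; rewrite /= addrA -scalerDl [_%:A]mulr1.
split; first by rewrite /derivable /= -e.
by rewrite /derive /= -e.
Qed.

Lemma MVT_line f x v :
  (forall s : R, s \in `[0, 1] -> derivable f (s *: v + x) v) ->
  exists2 s : R, s \in `[0, 1] & f (v + x) - f x = 'D_v f (s *: v + x).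
Proof.
move=> df.
have isd (s : R) : s \in `[0, 1] ->
    is_derive s 1 (fun r : R => f (r *: v + x)) ('D_v f (s *: v + x)).
  by move=> s01; apply/is_derive_line/derivableP/df.
pose F (r : R) := f (r *: v + x); pose dF (r : R) := 'D_v f (r *: v + x).
have isd' (s : R) : s \in `]0, 1[%R -> is_derive s 1 F (dF s).
  by move=> s01; apply: isd; apply: subset_itv_oo_cc s01.
have cF : {within `[0, 1], continuous F}.
  by apply: derivable_within_continuous => s /isd [].
have [c c01 e] := MVT ltr01 isd' cF.
exists c; first exact: subset_itv_oo_cc c01.
by move: e; rewrite /F scale1r scale0r add0r subr0 mulr1.
Qed.

End Lines.

Lemma continuous_slice (T U W : topologicalType) (f : T * U -> W) (x : T)
    (t : U) :
  {for (x, t), continuous f} -> {for t, continuous (fun t' => f (x, t'))}.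
Proof.
move=> cf; have ct : (x, t') @[t' --> t] --> (x, t).
  by apply: cvg_pair => /=; [exact: cvg_cst|exact: cvg_id].
exact: (cvg_comp _ _ ct cf).
Qed.

Section Mean.
Context (R : realType).
Implicit Types (f g F : R -> R).

Definition mean01 f : R := (\int[@lebesgue_measure R]_(t in `[0%R, 1%R]) f t)%R.

Lemma mean01_integrable f : {in `[0, 1], continuous f} ->
  (@lebesgue_measure R).-integrable `[0, 1] (EFin \o f).
Proof.
move=> cf; apply: continuous_compact_integrable; first exact: segment_compact.
by apply: continuous_in_subspaceT => x; rewrite inE => /cf.
Qed.

Lemma eq_mean01 f g : {in `[0, 1], f =1 g} -> mean01 f = mean01 g.
Proof. by move=> fg; apply: eq_Rintegral => t; rewrite inE => /fg. Qed.

Lemma mean01D f g : {in `[0, 1], continuous f} -> {in `[0, 1], continuous g} ->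
  mean01 (fun t => f t + g t) = mean01 f + mean01 g.
Proof.
by move=> cf cg; rewrite /mean01 RintegralD//; apply: mean01_integrable.
Qed.

Lemma mean01B f g : {in `[0, 1], continuous f} -> {in `[0, 1], continuous g} ->
  mean01 (fun t => f t - g t) = mean01 f - mean01 g.
Proof.
by move=> cf cg; rewrite /mean01 RintegralB//; apply: mean01_integrable.
Qed.

Lemma mean01_cst (c : R) : mean01 (fun=> c) = c.
Proof.
rewrite /mean01 Rintegral_cst//.
have e := lebesgue_measure_itv (R := R) `[0, 1].
rewrite /= lte_fin ltr01 -EFinB subr0 in e.
by rewrite [X in fine X](e : _ = _) mulr1.
Qed.

Lemma le_mean01 f g : {in `[0, 1], continuous f} -> {in `[0, 1], continuous g} ->
  {in `[0, 1], forall t, f t <= g t} -> mean01 f <= mean01 g.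
Proof.
move=> cf cg fg; apply: le_Rintegral (mean01_integrable cf) (mean01_integrable cg) _.
  exact: measurable_itv.
by move=> t /=; exact: fg.
Qed.

Lemma ler_norm_mean01 f (c : R) : {in `[0, 1], continuous f} ->
  {in `[0, 1], forall t, `|f t| <= c} -> `|mean01 f| <= c.
Proof.
move=> cf fc; apply: le_trans (le_normr_Rintegral _ (mean01_integrable cf)) _ => //.
rewrite -[leRHS]mean01_cst; apply: le_mean01 => //.
- by move=> t /cf ct; apply: cvg_norm.
- by move=> t _; exact: cvg_cst.
Qed.

Lemma mean01_FTC f F : {in `[0, 1], continuous f} ->
  {in `[0, 1], forall t : R, is_derive t 1 F (f t)} -> mean01 f = F 1 - F 0.
Proof.
move=> cf dF.
have cF t : t \in `[0, 1] -> {for t, continuous F}.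
  by move=> /dF [dFt _]; apply/differentiable_continuous/derivable1_diffP.
rewrite /mean01 /Rintegral (@continuous_FTC2 _ f F 0 1) //.
- by apply: continuous_in_subspaceT => x; rewrite inE => /cf.
- split.
  + by move=> t /subset_itv_oo_cc/dF[].
  + by apply: cvg_at_right_filter; apply: cF; rewrite in_itv/= lexx ler01.
  + by apply: cvg_at_left_filter; apply: cF; rewrite in_itv/= lexx ler01.
- by move=> t /subset_itv_oo_cc/dF[_ <-]; rewrite derive1E.
Qed.

(** Tube lemma: by compactness of the interval, pointwise joint continuity along
    [{x} * [0, 1]] already gives a uniform estimate near [x]. *)
Lemma near_uniform01 (T : topologicalType) (F : T -> R -> R) (x : T) (e : R) :
  0 < e ->
  (forall t, t \in `[0, 1] -> {for (x, t), continuous (fun p => F p.1 p.2)}) ->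
  \forall y \near x, forall t, t \in `[0, 1] -> `|F y t - F x t| <= e.
Proof.
move=> e0 cF.
have /compact_near_coveringP cpt := @segment_compact R 0 1.
apply: (cpt T (nbhs x) (fun y t => `|F y t - F x t| <= e)) => t t01.
have /cvgrPdist_lt/(_ (e / 2) (divr_gt0 e0 (ltr0Sn _ 1))) nF := cF t t01.
have nF2 : \forall t' \near t & y \near x, `|F x t - F y t'| < e / 2.
  case: nF => -[A B]/= [nA nB] AB; exists (B, A) => //= -[t' y] [/= Bt' Ay].
  by have := AB (y, t'); exact.
case: nF2 => -[B A]/= [nB nA] AB; exists (B, A) => //= -[t' y] [/= Bt' Ay].
have := AB (t', y) (conj Bt' Ay); have := AB (t', x) (conj Bt' (nbhs_singleton nA)).
move=> /= h1 h2; have -> : F y t' - F x t' = - (F x t - F y t') + (F x t - F x t').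
  by ring.
rewrite (le_trans (ler_normD _ _))// normrN [leRHS]splitr lerD// ltW//.
Qed.

Lemma mean01_continuous (T : topologicalType) (F : T -> R -> R) (x : T) :
  (\forall y \near x, {in `[0, 1], continuous (F y)}) ->
  (forall t, t \in `[0, 1] -> {for (x, t), continuous (fun p => F p.1 p.2)}) ->
  {for x, continuous (fun y => mean01 (F y))}.
Proof.
move=> nF cF; apply/cvgrPdist_le => e e0.
have nu := near_uniform01 e0 cF; near=> y.
have cFx : {in `[0, 1], continuous (F x)} by exact: (nbhs_singleton nF).
have cFy : {in `[0, 1], continuous (F y)} by near: y; exact: nF.
rewrite -mean01B//; apply: ler_norm_mean01.
  by move=> t t01; apply: cvgB; [exact: cFx|exact: cFy].
have uy : forall t, t \in `[0, 1] -> `|F y t - F x t| <= e by near: y.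
by move=> t t01; rewrite distrC uy.
Unshelve. all: by end_near. Qed.

(** The tube lemma bounds the parameter derivative near [s = 0] by the integrable
    function [`|dF 0 t| + 1], which is all that dominated convergence needs. *)
Lemma is_derive_mean01 (F dF : R -> R -> R) :
  (\forall s \near (0 : R), {in `[0, 1], continuous (F s)}) ->
  (\forall s \near (0 : R), {in `[0, 1],
      forall t, is_derive (s : R) (1 : R) (F ^~ t) (dF s t)}) ->
  (forall t, t \in `[0, 1] ->
      {for ((0 : R), t), continuous (fun p => dF p.1 p.2)}) ->
  is_derive (0 : R) 1 (fun s => mean01 (F s)) (mean01 (dF 0)).
Proof.
move=> cF dFE cdF.
have nd := near_uniform01 ltr01 cdF.
have : \forall s \near (0:R), [/\ {in `[0, 1], continuous (F s)},
   {in `[0, 1], forall t, is_derive (s : R) (1 : R) (F ^~ t) (dF s t)} &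
   forall t, t \in `[0, 1] -> `|dF s t - dF 0 t| <= 1].
  by near=> s; split; near: s.
move=> /nbhs_ballP[/= r r0 rP].
have {}rP s : s \in `](- r), r[ -> [/\ {in `[0, 1], continuous (F s)},
   {in `[0, 1], forall t, is_derive (s : R) (1 : R) (F ^~ t) (dF s t)} &
   forall t, t \in `[0, 1] -> `|dF s t - dF 0 t| <= 1].
  move=> sr; apply: rP; rewrite /ball/= sub0r normrN ltr_norml.
  by move: sr; rewrite in_itv.
have c0 : {in `[0, 1], continuous (dF 0)}.
  by move=> t t01; exact: (continuous_slice (cdF t t01)).
have I0 : (0 : R) \in `](- r), r[ by rewrite in_itv/= oppr_lt0 r0.
pose G t := `|dF 0 t| + 1.
have intG : (@lebesgue_measure R).-integrable `[0, 1] (EFin \o G).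
  apply: mean01_integrable => t /c0 ct; apply: cvgD; first exact: cvg_norm.
  exact: cvg_cst.
have I1 s : `](- r), r[%classic s -> (@lebesgue_measure R).-integrable `[0, 1] (EFin \o F s).
  by move=> /rP[cFs _ _]; exact: mean01_integrable.
have I2 s t : `](- r), r[%classic s -> `[0, 1]%classic t -> derivable (F ^~ t) s 1.
  by move=> /rP[_ ds _] /ds [].
have I3 t : 0 <= G t by rewrite addr_ge0.
have E s t : s \in `](- r), r[ -> t \in `[0, 1] -> partial1of2 F s t = dF s t.
  by move=> /rP[_ ds _] /ds [_ <-]; rewrite partial1of2E.
have I4 s t : `](- r), r[%classic s -> `[0, 1]%classic t -> `|partial1of2 F s t| <= G t.
  move=> sr t01; rewrite E//; have [_ _ /(_ t t01)] := rP _ sr.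
  rewrite /G => h; rewrite -(subrK (dF 0 t) (dF s t)) addrC.
  by rewrite (le_trans (ler_normD _ _))// lerD2l.
split.
  exact: (derivable_under_integral _ I0 I1 I2 I3 intG I4).
rewrite -derive1E (differentiation_under_integral _ I0 I1 I2 I3 intG I4)//.
by apply: eq_mean01 => t t01; rewrite E.
Unshelve. all: by end_near. Qed.

Lemma is_derive_mean01_dir (V : normedModType R) (F dF : V -> R -> R) (x v : V) :
  (\forall y \near x, {in `[0, 1], continuous (F y)}) ->
  (\forall y \near x, {in `[0, 1], forall t, is_derive y v (F ^~ t) (dF y t)}) ->
  (forall t, t \in `[0, 1] -> {for (x, t), continuous (fun p => dF p.1 p.2)}) ->
  is_derive x v (fun y => mean01 (F y)) (mean01 (dF x)).
Proof.
move=> cF dFE cdF.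
have lx : (fun s : R => s *: v + x) s @[s --> (0 : R)] --> x.
  rewrite -[X in _ --> X](add0r x) -[X in _ --> X + x](scale0r v).
  by apply: cvgD; [apply: cvgZr_tmp; exact: cvg_id|exact: cvg_cst].
pose G s t := F (s *: v + x) t; pose dG s t := dF (s *: v + x) t.
have cG : \forall s \near (0 : R), {in `[0, 1], continuous (G s)}.
  exact: lx cF.
have dGE : \forall s \near (0 : R), {in `[0, 1],
    forall t, is_derive (s : R) (1 : R) (G ^~ t) (dG s t)}.
  have nF : \forall s \near (0 : R), {in `[0, 1], forall t,
      is_derive (s *: v + x) v (F ^~ t) (dF (s *: v + x) t)} by exact: lx _ dFE.
  near=> s => t t01.
  have ds : {in `[0, 1], forall t,
      is_derive (s *: v + x) v (F ^~ t) (dF (s *: v + x) t)} by near: s.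
  exact: (is_derive_line (ds t t01)).
have cdG t : t \in `[0, 1] -> {for ((0 : R), t), continuous (fun p => dG p.1 p.2)}.
  move=> t01; have cl : (p.1 *: v + x, p.2) @[p --> ((0 : R), t)] --> (x, t).
    have c1 : (p : R * R).1 @[p --> ((0 : R), t)] --> (0 : R) by exact: cvg_fst.
    have c2 : (p : R * R).2 @[p --> ((0 : R), t)] --> t by exact: cvg_snd.
    exact: (cvg_pair (cvg_comp _ _ c1 lx) c2).
  have dG0 : dG 0 t = dF x t by rewrite /dG scale0r add0r.
  by have := cvg_comp _ _ cl (cdF t t01); rewrite /prop_for /continuous_at /= dG0.
have [d1 d2] := is_derive_mean01 cG dGE cdG.
rewrite /G /dG scale0r add0r in d1 d2.
split; first exact/derivable1P.
rewrite -d2 /derive; set g1 := fun h => h^-1 *: _; set g2 := fun h => h^-1 *: _.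
suff -> : g1 = g2 by [].
by apply/funext => h; rewrite /g1 /g2 /= addr0 scale0r add0r [_%:A]mulr1.
Unshelve. all: by end_near. Qed.

End Mean.

(** * Averages over periods *)

Section Averages.
Context (R : realType) (V : normedModType R) (D : set V).
Hypothesis oD : open D.
Implicit Types (f g : V -> R) (l u v x : V) (s : seq V).

Definition cont_on f := forall x, D x -> {for x, continuous f}.

(** Weaker than continuous Frechet differentiability on the face of it; this
    directional form passes through integrals without any norm estimate on the
    differential. *)
Definition C1_on f :=
  forall x, D x -> {for x, continuous f} /\
    forall v, derivable f x v /\ {for x, continuous ('D_v f)}.

Lemma C1_cont f : C1_on f -> cont_on f.
Proof. by move=> cf x /cf[]. Qed.

Lemma C1_derivable f x v : C1_on f -> D x -> derivable f x v.
Proof. by move=> cf /cf[_ /(_ v)[]]. Qed.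

Lemma C1_derive f v : C1_on f -> cont_on ('D_v f).
Proof. by move=> cf x /cf[_ /(_ v)[]]. Qed.

Lemma near_open x : D x -> \forall y \near x, D y.
Proof. by move=> Dx; apply: open_nbhs_nbhs. Qed.

Lemma near_eq_on f g x : (forall y, D y -> f y = g y) -> D x ->
  \forall y \near x, f y = g y.
Proof. by move=> fg /near_open; apply: filterS. Qed.

Lemma eq_cont_on f g : (forall y, D y -> f y = g y) -> cont_on f -> cont_on g.
Proof.
move=> fg cf x Dx; have nfg := near_eq_on fg Dx.
rewrite /prop_for /continuous_at -(fg x Dx).
apply: cvg_trans (cf x Dx); apply: near_eq_cvg.
by near=> y; near: y.
Unshelve. all: by end_near. Qed.

Lemma is_derive_lincomb f g (k l : R) x v : derivable f x v -> derivable g x v ->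
  is_derive x v (fun y => k * f y + l * g y) (k * 'D_v f x + l * 'D_v g x).
Proof.
move=> df dg; have := @is_deriveD _ _ _ (k *: f) (l *: g) x v _ _
  (is_deriveZ k (derivableP df)) (is_deriveZ l (derivableP dg)).
exact.
Qed.

Lemma C1_on_lincomb f g (k l : R) : C1_on f -> C1_on g ->
  C1_on (fun y => k * f y + l * g y).
Proof.
move=> cf cg x Dx; have [fc fd] := cf x Dx; have [gc gd] := cg x Dx.
split; first by apply: cvgD; apply: cvgMl_tmp.
move=> v; have [dfv cfv] := fd v; have [dgv cgv] := gd v.
split; first by have [] := is_derive_lincomb k l dfv dgv.
suff H : cont_on ('D_v (fun y => k * f y + l * g y)) by exact: H.
apply: (eq_cont_on (f := fun y => k * 'D_v f y + l * 'D_v g y)) => y Dy.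
  by have [_ ->] := is_derive_lincomb k l (C1_derivable (v := v) cf Dy)
    (C1_derivable (v := v) cg Dy).
by apply: cvgD; apply: cvgMl_tmp; exact: C1_derive Dy.
Qed.

(** The domain is a union of full lines in the direction [l]. *)
Definition stable l := forall x, D x -> forall t : R, D (t *: l + x).

(** When [f] has period [l], this is its mean over the circle that the direction
    [l] closes up to in the quotient. *)
Definition avg l f : V -> R := fun x => mean01 (fun t => f (t *: l + x)).

Lemma cvg_shift_line l x (t : R) :
  (p.2 *: l + p.1) @[p --> (x, t)] --> t *: l + x.
Proof.
have c1 : (p : V * R).1 @[p --> (x, t)] --> x by exact: cvg_fst.
have c2 : (p : V * R).2 @[p --> (x, t)] --> t by exact: cvg_snd.
by apply: cvgD c1; apply: cvgZr_tmp.
Qed.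

Lemma cont_shift_line f l x (t : R) : cont_on f -> D (t *: l + x) ->
  {for (x, t), continuous (fun p : V * R => f (p.2 *: l + p.1))}.
Proof.
by move=> cf Dx; exact: (cvg_comp _ _ (@cvg_shift_line l x t) (cf _ Dx)).
Qed.

Lemma cont_line f l x : cont_on f -> (forall t : R, D (t *: l + x)) ->
  continuous (fun t : R => f (t *: l + x)).
Proof.
by move=> cf Dx t; exact: (continuous_slice (cont_shift_line cf (Dx t))).
Qed.

Lemma avg_cont l f : stable l -> cont_on f -> cont_on (avg l f).
Proof.
move=> sl cf x Dx; apply: mean01_continuous.
  apply: filterS (near_open Dx) => y Dy t _.
  by apply: cont_line => // r; exact: sl.
by move=> t _; exact: cont_shift_line (sl _ Dx t).
Qed.

Lemma is_derive_avg l f x v : stable l -> C1_on f -> D x ->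
  is_derive x v (avg l f) (avg l ('D_v f) x).
Proof.
move=> sl cf Dx.
have cF : \forall y \near x, {in `[0, 1], continuous (fun t : R => f (t *: l + y))}.
  apply: filterS (near_open Dx) => y Dy t _.
  by apply: cont_line (C1_cont cf) _ _ => r; exact: sl.
have dF : \forall y \near x, {in `[0, 1], forall t : R,
    is_derive y v (fun y => f (t *: l + y)) ('D_v f (t *: l + y))}.
  apply: filterS (near_open Dx) => y Dy t _.
  have := derivableP (C1_derivable (v := v) cf (sl y Dy t)).
  set p := t *: l + y => -[d1 d2].
  have e : (fun h : R => h^-1 *: (f (h *: v + p) - f p)) =
           (fun h : R => h^-1 *: (f (t *: l + (h *: v + y)) - f (t *: l + y))).
    by apply/funext => h; rewrite /p addrCA.
  split; first by rewrite /derivable /= -e.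
  by rewrite /derive /= -e.
apply: (is_derive_mean01_dir cF dF) => t _.
exact: cont_shift_line (C1_derive cf) (sl _ Dx t).
Qed.

(** Differentiation in an arbitrary direction commutes with averaging, since
    averaging is a superposition of translations. *)
Lemma derive_avg l f x v : stable l -> C1_on f -> D x ->
  'D_v (avg l f) x = avg l ('D_v f) x.
Proof. by move=> sl cf Dx; have [_ ->] := is_derive_avg v sl cf Dx. Qed.

Lemma avg_C1 l f : stable l -> C1_on f -> C1_on (avg l f).
Proof.
move=> sl cf x Dx; split; first exact: avg_cont (C1_cont cf) _ Dx.
move=> v; split; first by have [] := is_derive_avg v sl cf Dx.
have : cont_on ('D_v (avg l f)); last exact.
apply: (eq_cont_on (f := avg l ('D_v f))) => [y Dy|]; first by rewrite derive_avg.
exact: avg_cont (C1_derive cf).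
Qed.

Lemma eq_avg l f g x : stable l -> (forall y, D y -> f y = g y) -> D x ->
  avg l f x = avg l g x.
Proof. by move=> sl fg Dx; apply: eq_mean01 => t _; apply/fg/sl. Qed.

Lemma avgD l f g x : stable l -> cont_on f -> cont_on g -> D x ->
  avg l (f \+ g) x = avg l f x + avg l g x.
Proof.
by move=> sl cf cg Dx; rewrite /avg mean01D // => t _; apply: cont_line => // r;
  exact: sl.
Qed.

Lemma avg_cst l (c : R) x : avg l (fun=> c) x = c.
Proof. exact: mean01_cst. Qed.

(** Fundamental theorem of calculus along the loop closed up by the period. *)
Lemma avg_derive_periodic l f x : stable l -> C1_on f -> D x ->
  f (l + x) = f x -> avg l ('D_l f) x = 0.
Proof.
move=> sl cf Dx per; rewrite /avg (mean01_FTC (F := fun t => f (t *: l + x))).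
- by rewrite scale1r scale0r add0r per subrr.
- by move=> t _; apply: cont_line (C1_derive cf) _ _ => r; exact: sl.
- by move=> t _; apply/is_derive_line/derivableP/C1_derivable => //; exact: sl.
Qed.

(** Iterated average; for [s] a basis of a lattice of periods, the mean over a
    fundamental parallelotope, hence over the torus. *)
Definition avgs s f : V -> R := foldr avg f s.

Lemma stable_cons l s : {in l :: s, forall l, stable l} ->
  stable l /\ {in s, forall l, stable l}.
Proof. by move=> /forall_cons[]. Qed.

Lemma avgs_cont s f : {in s, forall l, stable l} -> cont_on f -> cont_on (avgs s f).
Proof.
by elim: s => //= l s IH /stable_cons[sl ss] cf; exact: avg_cont (IH ss cf).
Qed.

Lemma avgs_C1 s f : {in s, forall l, stable l} -> C1_on f -> C1_on (avgs s f).
Proof.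
elim: s => [//|l s IH /stable_cons[sl ss] cf].
exact: avg_C1 (IH ss cf).
Qed.

Lemma derive_avgs s f x v : {in s, forall l, stable l} -> C1_on f -> D x ->
  'D_v (avgs s f) x = avgs s ('D_v f) x.
Proof.
elim: s x => //= l s IH x /stable_cons[sl ss] cf Dx.
rewrite (derive_avg _ sl (avgs_C1 ss cf) Dx).
by apply: (eq_avg sl _ Dx) => y Dy; exact: IH.
Qed.

Lemma avgs_periodic s f x u : stable u -> {in s, forall l, stable l} -> D x ->
  (forall y, D y -> f (u + y) = f y) -> avgs s f (u + x) = avgs s f x.
Proof.
move=> su; elim: s x => //= [x _ Dx ->//|l s IH x /stable_cons[sl ss] Dx per].
by apply: eq_mean01 => t _; rewrite addrCA; exact: (IH _ ss (sl _ Dx t) per).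
Qed.

Lemma eq_avgs s f g x : {in s, forall l, stable l} ->
  (forall y, D y -> f y = g y) -> D x -> avgs s f x = avgs s g x.
Proof.
elim: s x => //= [x _ fg Dx|l s IH x /stable_cons[sl ss] fg Dx].
  exact: fg.
by apply: (eq_avg sl _ Dx) => y Dy; exact: (IH _ ss fg Dy).
Qed.

Lemma avgsD s f g x : {in s, forall l, stable l} -> cont_on f -> cont_on g ->
  D x -> avgs s (f \+ g) x = avgs s f x + avgs s g x.
Proof.
elim: s x => //= l s IH x /stable_cons[sl ss] cf cg Dx.
rewrite -(avgD sl (avgs_cont ss cf) (avgs_cont ss cg) Dx).
by apply: (eq_avg sl _ Dx) => y Dy; exact: (IH _ ss cf cg Dy).
Qed.

Lemma avgs_cst s (c : R) x : avgs s (fun=> c) x = c.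
Proof.
elim: s x => //= l s IH x; rewrite -[RHS](avg_cst l c x).
by apply: eq_mean01 => t _; exact: IH.
Qed.

(** The averages that are taken before the one along [u] commute with ['D_u] and
    preserve the period [u], which leaves the one-dimensional case. *)
Lemma avgs_derive_periodic s f x u : u \in s -> {in s, forall l, stable l} ->
  C1_on f -> (forall y, D y -> f (u + y) = f y) -> D x -> avgs s ('D_u f) x = 0.
Proof.
elim: s x => //= l s IH x us ss cf per Dx.
have su : stable u by exact: ss.
have [sl {}ss] := stable_cons ss.
move: us; rewrite inE => /predU1P[ul|us]; last first.
  rewrite -[RHS](avg_cst l 0 x).
  by apply: (eq_avg sl _ Dx) => y Dy; exact: (IH _ us ss cf per Dy).
have cfs := avgs_C1 ss cf.
rewrite -ul (eq_avg (g := 'D_u (avgs s f)) su _ Dx); last first.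
  by move=> y Dy; rewrite (derive_avgs _ ss cf Dy).
exact: (avg_derive_periodic su cfs Dx (avgs_periodic su ss Dx per)).
Qed.

(** Stokes' theorem on the torus: a divergence has mean zero. *)
Lemma avgs_sum_derive n (u : 'I_n -> V) (g : 'I_n -> V -> R) s x :
  (forall i, u i \in s) -> {in s, forall l, stable l} ->
  (forall i, C1_on (g i)) -> (forall i y, D y -> g i (u i + y) = g i y) ->
  D x -> avgs s (fun y => \sum_i 'D_(u i) (g i) y) x = 0.
Proof.
move=> us ss cg per Dx.
suff H (r : seq 'I_n) : cont_on (fun y => \sum_(i <- r) 'D_(u i) (g i) y) /\
    avgs s (fun y => \sum_(i <- r) 'D_(u i) (g i) y) x = 0 by have [] := H (index_enum _).
elim: r => [|i r [IHc IH]].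
  under [X in cont_on X]eq_fun do rewrite big_nil.
  by under [X in avgs s X]eq_fun do rewrite big_nil; split;
    [move=> y _; exact: cvg_cst|rewrite avgs_cst].
under [X in cont_on X]eq_fun do rewrite big_cons.
under [X in avgs s X]eq_fun do rewrite big_cons.
have ci := C1_derive (v := u i) (cg i).
split; first by move=> y Dy; apply: cvgD; [exact: ci|exact: IHc].
rewrite (avgsD ss ci IHc Dx) IH addr0.
exact: (avgs_derive_periodic (us i) ss (cg i) (per i) Dx).
Qed.

(** The set [P] records where the averaged points stay, such as a slice. *)
Lemma avgs_bounded s f (P : set V) (m M : R) x : {in s, forall l, stable l} ->
  cont_on f -> D x -> P x ->
  {in s, forall l y (t : R), P y -> P (t *: l + y)} ->
  (forall y, D y -> P y -> m <= f y <= M) -> m <= avgs s f x <= M.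
Proof.
elim: s x => /= [x _ _ Dx Px _ ->//|l s IH x /stable_cons[sl ss] cf Dx Px Ps mM].
have Pl : forall y (t : R), P y -> P (t *: l + y) by apply: Ps; rewrite mem_head.
have {}Ps : {in s, forall l y (t : R), P y -> P (t *: l + y)}.
  by move=> m' ms; apply: Ps; rewrite inE ms orbT.
have c : {in `[0, 1], continuous (fun t : R => avgs s f (t *: l + x))}.
  by move=> t _; apply: cont_line (avgs_cont ss cf) _ _ => r; exact: sl.
have c0 (k : R) : {in `[0, 1], continuous (fun t : R => k)}.
  by move=> t _; exact: cvg_cst.
have B (t : R) : m <= avgs s f (t *: l + x) <= M.
  exact: (IH _ ss cf (sl _ Dx t) (Pl _ t Px) Ps mM).
rewrite -{1}[m]mean01_cst -{1}[M]mean01_cst; apply/andP; split;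
  by apply: le_mean01 => // t _; have /andP[] := B t.
Qed.

End Averages.

(** * Smooth functions and real coordinates *)

Section Smooth.
Context (R : realType) (V : normedModType R) (D : set V).
Hypothesis oD : open D.
Implicit Types (f g : V -> R) (u v x : V).

Lemma smooth_differentiable f x : smooth_on D f -> D x -> differentiable f x.
Proof. by move=> sf Dx; exact: (sf [::] x Dx). Qed.

Lemma smooth_on_derive f v : smooth_on D f -> smooth_on D ('D_v f).
Proof. by move=> sf vs x Dx; have := sf (rcons vs v) x Dx; rewrite foldr_rcons. Qed.

(** The innermost derivative of the iterated ones is the last vector of the
    list, whence the induction from the right. *)
Lemma smooth_on_intro f : (forall x, D x -> differentiable f x) ->
  (forall v, smooth_on D ('D_v f)) -> smooth_on D f.
Proof.
move=> df sf vs x Dx; case/lastP: vs => [|vs v]; first exact: df.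
by rewrite foldr_rcons; exact: sf.
Qed.

Lemma eq_foldr_derive f g vs x : (forall y, D y -> f y = g y) -> D x ->
  foldr (fun v h => 'D_v h : V -> R) f vs x =
  foldr (fun v h => 'D_v h : V -> R) g vs x.
Proof.
move=> fg; elim: vs x => [|v vs IH] x Dx /=; first exact: fg.
by apply: near_eq_derive; exact: near_eq_on Dx.
Qed.

Lemma near_eq_differentiable f g x : (\forall y \near x, f y = g y) ->
  differentiable f x -> differentiable g x.
Proof.
move=> fg df; apply/diff_locallyP.
have e : g \o shift x = cst (g x) + 'd f x +o_ (0 : V) id.
  apply/eqaddoP => e e0.
  have := (diff_locally df); move=> /eqaddoP /(_ e e0) H.
  have fg0 : \forall h \near (0 : V), f (h + x) = g (h + x).
    by have := fg; rewrite (near_shift (0 : V) x) /=; apply: filterS => h /=; rewrite subr0.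
  near=> h.
  have -> : (g \o shift x - (cst (g x) + 'd f x)) h =
      (f \o shift x - (cst (f x) + 'd f x)) h.
    rewrite !fctE /= -(nbhs_singleton fg); congr (_ - _); apply/esym.
    by near: h.
  by near: h.
have c := diff_continuous df.
by rewrite (diff_unique c e).
Unshelve. all: by end_near. Qed.

Lemma eq_smooth_on f g : (forall y, D y -> f y = g y) ->
  smooth_on D f -> smooth_on D g.
Proof.
move=> fg sf vs x Dx; apply: near_eq_differentiable (sf vs x Dx).
by apply: filterS (near_open oD Dx) => y Dy; exact: eq_foldr_derive.
Qed.

Lemma smooth_C1 f : smooth_on D f -> C1_on D f.
Proof.
move=> sf x Dx; have df := smooth_differentiable sf Dx; split.
  exact: differentiable_continuous.
move=> v; split; first exact: diff_derivable.
exact: differentiable_continuous (smooth_differentiable (smooth_on_derive _ sf) Dx).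
Qed.

Lemma near_const_smooth f : (forall x, D x -> \forall y \near x, f y = f x) ->
  smooth_on D f.
Proof.
move=> cf vs x Dx.
have {Dx} : \forall y \near x, foldr (fun v h => 'D_v h : V -> R) f vs y =
    foldr (fun v h => 'D_v h : V -> R) f vs x.
  elim: vs x Dx => [|v vs IH] x Dx /=; first exact: cf.
  have d0 y : D y -> 'D_v (foldr (fun v h => 'D_v h : V -> R) f vs) y = 0.
    move=> Dy; rewrite (near_eq_derive (g := cst (foldr (fun v h => 'D_v h : V -> R) f vs y))).
      exact: derive_cst.
    exact: IH.
  by apply: filterS (near_open oD Dx) => y Dy; rewrite !d0.
move=> H; apply: near_eq_differentiable (differentiable_cst (foldr _ f vs x) x).
by apply: filterS H => y ->.
Qed.

Lemma derive_sum_dir n (u : 'I_n -> V) (c : 'I_n -> R) f x :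
  differentiable f x ->
  'D_(\sum_i c i *: u i) f x = \sum_i c i * 'D_(u i) f x.
Proof.
move=> df; rewrite deriveE// linear_sum; apply: eq_bigr => i _.
by rewrite linearZ deriveE.
Qed.

End Smooth.

(** A chain rule at the level of difference quotients, which coincide along an
    affine map. *)
Lemma derive_affine (R : realType) (V W : normedModType R) (E : W -> R)
    (p : V -> W) (x v : V) (w : W) :
  (forall h : R, p (h *: v + x) = h *: w + p x) ->
  'D_v (E \o p) x = 'D_w E (p x) /\
  (derivable E (p x) w -> derivable (E \o p) x v).
Proof.
move=> pE; have e : (fun h : R => h^-1 *: (E (h *: w + p x) - E (p x))) =
   (fun h : R => h^-1 *: ((E \o p) (h *: v + x) - (E \o p) x)).
  by apply/funext => h; rewrite /= pE.
by split; rewrite /derivable /derive /= e.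
Qed.

Section Coordinates.
Context (R : realType).
Implicit Types (u v x y : C2 R).

Definition basis_vec (i : 'I_4) : C2 R :=
  (((i == 0%N :> nat)%:R, (i == 1%N :> nat)%:R),
   ((i == 2%N :> nat)%:R, (i == 3%N :> nat)%:R)).

(** The real coordinates [w_1, w_2, z_1, z_2], numbered from 0. *)
Definition coord (i : 'I_4) (u : C2 R) : R :=
  nth 0 [:: u.1.1; u.1.2; u.2.1; u.2.2] i.

Lemma coord_linear i : linear (coord i).
Proof. by move=> k u v; rewrite /coord; case: i => -[|[|[|[|i]]]] h /=. Qed.

HB.instance Definition _ i :=
  GRing.isLinear.Build R (C2 R) R _ (coord i) (coord_linear i).

Lemma coord_basis u : u = \sum_i coord i u *: basis_vec i.
Proof.
rewrite !big_ord_recl big_ord0 addr0 /coord /basis_vec /=.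
case: u => -[u1 u2] [u3 u4] /=.
by congr ((_, _), (_, _)); rewrite /= ?[_ *: 0]mulr0 ?[_%:A]mulr1 ?addr0 ?add0r.
Qed.

Lemma coord_continuous i : continuous (coord i).
Proof.
move=> u; case: i => -[|[|[|[|]]]]// h; rewrite /continuous_at /coord /=.
- by apply: (cvg_comp fst fst); [exact: cvg_fst|exact: cvg_fst].
- by apply: (cvg_comp fst snd); [exact: cvg_fst|exact: cvg_snd].
- by apply: (cvg_comp snd fst); [exact: cvg_snd|exact: cvg_fst].
- by apply: (cvg_comp snd snd); [exact: cvg_snd|exact: cvg_snd].
Qed.

Lemma coord_differentiable i x : differentiable (coord i) x.
Proof. exact: (linear_differentiable x (@coord_continuous i)). Qed.

Lemma derive_coord i x v : 'D_v (coord i) x = coord i v.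
Proof.
rewrite deriveE; last exact: coord_differentiable.
by rewrite (diff_lin x (@coord_continuous i)).
Qed.

Lemma coord_le_norm i u : `|coord i u| <= `|u|.
Proof.
case: u => -[u1 u2] [u3 u4]; rewrite !prod_normE /= !le_max.
by case: i => -[|[|[|[|]]]]//= h; rewrite lexx ?orbT.
Qed.

End Coordinates.

(** * Primitives of closed 1-forms *)

Lemma continuous_big_sum (R : realType) (T : topologicalType) n
    (F : 'I_n -> T -> R) (x : T) : (forall i, {for x, continuous (F i)}) ->
  {for x, continuous (fun y => \sum_i F i y)}.
Proof.
move=> cF; apply: cvg_big => [|i _]; first exact: add_continuous.
exact: cF.
Qed.

Section Primitive.
Context (R : realType) (D : set (C2 R)).
Hypothesis oD : open D.
Implicit Types (u v x y : C2 R).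

Definition linear_on (theta : tensor1 R) := forall x, D x -> forall k u v,
  theta x (k *: u + v) = k * theta x u + theta x v.

Lemma linear_on_coord theta x u : linear_on theta -> D x ->
  theta x u = \sum_i coord i u * theta x (basis_vec R i).
Proof.
move=> lt Dx; pose l : {linear C2 R -> R} := HB.pack (theta x)
  (GRing.isLinear.Build R (C2 R) R _ (theta x) (lt x Dx)).
rewrite -[theta x]/(l : _ -> _) {1}(coord_basis u) linear_sum.
by apply: eq_bigr => i _; rewrite linearZ.
Qed.

(** By the mean value theorem on the segment from [x] to [h + x], the increment
    of [f] is the form [theta] at an intermediate point, evaluated at [h]; the
    continuity of its four components makes the error small against [h]. *)
Lemma partials_differentiable (f : C2 R -> R) (theta : tensor1 R) x :
  linear_on theta -> (forall v, cont_on D (fun y => theta y v)) ->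
  (forall y v, D y -> is_derive y v f (theta y v)) ->
  D x -> differentiable f x.
Proof.
move=> lt ct df Dx.
pose l : {linear C2 R -> R} := HB.pack (theta x)
  (GRing.isLinear.Build R (C2 R) R _ (theta x) (lt x Dx)).
have lE : (l : C2 R -> R) = theta x by [].
have cl : continuous l.
  rewrite lE (_ : theta x = fun u => \sum_i coord i u * theta x (basis_vec R i)).
    move=> u; apply: continuous_big_sum => i.
    by apply: cvgMr_tmp; exact: coord_continuous.
  by apply/funext => u; exact: linear_on_coord.
have e : f \o shift x = cst (f x) + l +o_ (0 : C2 R) id.
  apply/eqaddoP => e e0; have e4 : 0 < e / 4 by rewrite divr_gt0.
  have nD : \forall y \near x, D y /\ forall i : 'I_4,
      `|theta y (basis_vec R i) - theta x (basis_vec R i)| <= e / 4.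
    have nb : \forall y \near x, forall i : 'I_4,
        `|theta y (basis_vec R i) - theta x (basis_vec R i)| <= e / 4.
      apply: (@filter_forall _ _ (fun (i : 'I_4) y =>
        `|theta y (basis_vec R i) - theta x (basis_vec R i)| <= e / 4)
        (nbhs x) (nbhs_filter x)) => i.
      have /cvgrPdist_le/(_ _ e4) := ct (basis_vec R i) x Dx.
      by apply: filterS => y; rewrite distrC.
    exact: (filterI (near_open oD Dx) nb).
  move/nbhs_ballP: nD => [/= r r0 rP]; near=> h.
  have hr : `|h| < r by near: h; exact: cvgr0_norm_lt.
  have line (s : R) : s \in `[0, 1] -> ball x r (s *: h + x).
    rewrite in_itv/= => /andP[s0 s1]; rewrite -ball_normE /= opprD addrCA subrr addr0.
    rewrite normrN normrZ ger0_norm// (le_lt_trans _ hr)//.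
    by rewrite ler_piMl.
  have [s s01 Es] : exists2 s : R, s \in `[0, 1] & f (h + x) - f x = 'D_h f (s *: h + x).
    by apply: MVT_line => s /line/rP[Ds _]; have [] := df _ h Ds.
  have [Ds Hs] := rP _ (line s s01).
  rewrite !fctE /= opprD addrA Es; have [_ ->] := df _ h Ds.
  rewrite (linear_on_coord _ lt Ds) (linear_on_coord _ lt Dx) -sumrB.
  apply: (le_trans (ler_norm_sum _ _ _)).
  apply: (@le_trans _ _ (\sum_(i < 4) `|h| * (e / 4))).
    apply: ler_sum => i _; rewrite -mulrBr normrM.
    by apply: ler_pM => //; exact: coord_le_norm.
  by rewrite sumr_const card_ord -[X in X <= _]mulr_natr -mulrA divfK ?pnatr_eq0// mulrC.
apply/diff_locallyP; rewrite (diff_unique cl e); split => //.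
Unshelve. all: by end_near. Qed.

Context (x0 : C2 R) (eta : tensor1 R).
Hypothesis star : forall x (t : R), D x -> t \in `[0, 1] -> D (t *: (x - x0) + x0).
Hypothesis eta_smooth : forall u, smooth_on D (fun x => eta x u).
Hypothesis eta_linear : linear_on eta.
Hypothesis eta_closed : forall x, D x -> forall u v, ext_d1 eta x u v = 0.

(** The integral of the form along the segment from the base point. *)
Definition primitive : C2 R -> R :=
  fun x => mean01 (fun t => eta (t *: (x - x0) + x0) (x - x0)).

Let g i : C2 R -> R := fun y => eta y (basis_vec R i).
Let path (y : C2 R) (t : R) : C2 R := t *: (y - x0) + x0.

Let path_cvg x (t : R) : path p.1 p.2 @[p --> (x, t)] --> path x t.
Proof.
have c1 : (p : C2 R * R).1 @[p --> (x, t)] --> x by exact: cvg_fst.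
have c2 : (p : C2 R * R).2 @[p --> (x, t)] --> t by exact: cvg_snd.
apply: cvgD; last exact: cvg_cst.
by apply: cvgZ c2 _; apply: cvgB c1 _; exact: cvg_cst.
Qed.

Let path_cont x (t : R) (f : C2 R -> R) : cont_on D f -> D (path x t) ->
  {for (x, t), continuous (fun p : C2 R * R => f (path p.1 p.2))}.
Proof. by move=> cf Dp; exact: (cvg_comp _ _ (@path_cvg x t) (cf _ Dp)). Qed.

Let g_differentiable i y : D y -> differentiable (g i) y.
Proof. by move=> Dy; exact: (smooth_differentiable (eta_smooth _) Dy). Qed.

(* The derivative in the direction v of the integrand of the primitive. *)
Let dF (v y : C2 R) (t : R) : R :=
  \sum_i (coord i v * g i (path y t) + coord i (y - x0) * (t * 'D_v (g i) (path y t))).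

Let F_derive v y (t : R) : D y -> t \in `[0, 1] ->
  is_derive y v (fun y => eta (path y t) (y - x0)) (dF v y t).
Proof.
move=> Dy t01; have Dp := star Dy t01.
have gd i : is_derive y v (g i \o path^~ t) (t * 'D_v (g i) (path y t)).
  have aff (h : R) : path (h *: v + y) t = h *: (t *: v) + path y t.
    by rewrite /path scalerA mulrC -scalerA addrA -scalerDr addrA.
  have [e d] := derive_affine (g i) (p := path^~ t) aff.
  split; first by apply: d; apply: diff_derivable; exact: g_differentiable.
  rewrite e !deriveE; [|exact: g_differentiable..].
  by rewrite linearZ.
have cd i : is_derive y v (fun y => coord i (y - x0)) (coord i v).
  have aff (h : R) : (h *: v + y) - x0 = h *: v + (y - x0) by rewrite addrA.
  have [e d] := derive_affine (coord i) (p := fun y => y - x0) aff.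
  split; first by apply: d; apply: diff_derivable; exact: coord_differentiable.
  by rewrite e derive_coord.
have nD : \forall z \near y, D (path z t).
  have c : path z t @[z --> y] --> path y t.
    apply: cvgD; last exact: cvg_cst.
    by apply: cvgZl_tmp; apply: cvgB; [exact: cvg_id|exact: cvg_cst].
  exact: (c _ (near_open oD Dp)).
apply: (@near_eq_is_derive _ _ _
   (\sum_i (fun y => coord i (y - x0)) * (g i \o path^~ t))).
  apply: filterS nD => z Dz.
  rewrite fct_sumE [RHS](linear_on_coord _ eta_linear Dz).
  by apply: eq_bigr.
have -> : dF v y t = \sum_i (coord i (y - x0) *: (t * 'D_v (g i) (path y t)) +
     (g i \o path^~ t) y *: coord i v).
  by apply: eq_bigr => i _; rewrite addrC [X in _ = _ + X]mulrC.
apply: is_derive_sum => i; exact: is_deriveM.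
Qed.

(** Poincare lemma: closedness turns the derivative of the integrand along [v]
    into the [t]-derivative of [t * eta (path x t) v]. *)
Lemma is_derive_primitive x v : D x -> is_derive x v primitive (eta x v).
Proof.
move=> Dx.
have cF : \forall y \near x, {in `[0, 1], continuous (fun t => eta (path y t) (y - x0))}.
  apply: filterS (near_open oD Dx) => y Dy t t01; have Dp := star Dy t01.
  have c := path_cont (C1_cont (smooth_C1 (eta_smooth (y - x0)))) Dp.
  exact: (continuous_slice c).
have dFE : \forall y \near x, {in `[0, 1], forall t : R,
     is_derive y v (fun y => eta (path y t) (y - x0)) (dF v y t)}.
  by apply: filterS (near_open oD Dx) => y Dy t t01; exact: F_derive.
have cdF (t : R) : t \in `[0, 1] -> {for (x, t), continuous (fun p => dF v p.1 p.2)}.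
  move=> t01; have Dp := star Dx t01.
  have c1 : (p : C2 R * R).1 @[p --> (x, t)] --> x by exact: cvg_fst.
  have c2 : (p : C2 R * R).2 @[p --> (x, t)] --> t by exact: cvg_snd.
  apply: continuous_big_sum => i; have ci := smooth_C1 (eta_smooth (basis_vec R i)).
  apply: cvgD.
    by apply: cvgMl_tmp; exact: (path_cont (C1_cont ci) Dp).
  apply: cvgM; last first.
    by apply: cvgM c2 _; exact: (path_cont (C1_derive ci) Dp).
  have c3 : (p : C2 R * R).1 - x0 @[p --> (x, t)] --> x - x0.
    by apply: cvgB c1 _; exact: cvg_cst.
  exact: (cvg_comp _ _ c3 (@coord_continuous R i _)).
suff -> : eta x v = mean01 (dF v x) by exact: (is_derive_mean01_dir cF dFE cdF).
have c0 : {in `[0, 1], continuous (dF v x)}.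
  by move=> t t01; exact: (continuous_slice (cdF t t01)).
rewrite (mean01_FTC (F := fun t => t * eta (path x t) v) c0).
  by rewrite mul0r subr0 mul1r /path scale1r subrK.
move=> t t01; have Dp := star Dx t01.
have dev := smooth_differentiable (eta_smooth v) Dp.
have dl : is_derive t 1 (fun t => eta (path x t) v) ('D_(x - x0) (eta^~ v) (path x t)).
  apply: (is_derive_line (f := eta^~ v)); apply: derivableP.
  exact: diff_derivable.
have -> : dF v x t = t *: 'D_(x - x0) (eta^~ v) (path x t) + eta (path x t) v *: 1.
  rewrite /dF big_split /= addrC; congr (_ + _); last first.
    by rewrite [RHS]mulr1 [RHS](linear_on_coord _ eta_linear Dp).
  have -> : 'D_(x - x0) (eta^~ v) (path x t) =
      \sum_i coord i (x - x0) * 'D_(basis_vec R i) (eta^~ v) (path x t).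
    by rewrite {1}(coord_basis (x - x0)) (derive_sum_dir _ _ dev).
  rewrite [RHS]mulr_sumr; apply: eq_bigr => i _; rewrite mulrCA; congr (_ * (_ * _)).
  by have /eqP := eta_closed Dp (basis_vec R i) v; rewrite subr_eq0 => /eqP ->.
exact: is_deriveM.
Qed.

Lemma primitive_smooth : smooth_on D primitive.
Proof.
apply: smooth_on_intro => [x Dx|v].
  apply: (partials_differentiable eta_linear _ _ Dx).
    by move=> v; exact: C1_cont (smooth_C1 (eta_smooth v)).
  by move=> y v Dy; exact: is_derive_primitive.
apply: (eq_smooth_on oD (f := fun x => eta x v)) (eta_smooth v) => y Dy.
by have [_ ->] := is_derive_primitive v Dy.
Qed.

End Primitive.

(** * Eigenvectors of the monodromy matrix *)

Section Eigen.
Local Open Scope complex_scope.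
Context (R : realType) (M : 'M[int]_3) (alpha : R) (beta : R[i])
  (a : 'cV[R]_3) (b : 'cV[R[i]]_3).
Hypotheses (detM : \det M = 1) (alpha_gt1 : 1 < alpha)
  (beta_nonreal : beta != conjc beta) (a_neq0 : a != 0) (b_neq0 : b != 0)
  (a_eigen : map_mx intr M *m a = alpha *: a)
  (b_eigen : map_mx intr M *m b = beta *: b).

Let N : 'M[R[i]]_3 := (map_mx intr M)^T.

Lemma root_char_eigen (v : 'cV[R[i]]_3) (z : R[i]) : v != 0 ->
  map_mx intr M *m v = z *: v -> root (char_poly N) z.
Proof.
move=> v0 Mv; rewrite -eigenvalue_root_char; apply/eigenvalueP; exists v^T.
  by rewrite /N -trmx_mul Mv linearZ.
by rewrite -trmx0 (inj_eq trmx_inj).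
Qed.

Lemma eigen_conj : map_mx intr M *m map_mx conjc b = conjc beta *: map_mx conjc b.
Proof.
rewrite -map_mxZ -b_eigen map_mxM; congr (_ *m _).
by apply/matrixP => i j; rewrite !mxE rmorph_int.
Qed.

Lemma eigen_complex (v : 'cV[R]_3) (z : R) : map_mx intr M *m v = z *: v ->
  map_mx intr M *m map_mx (real_complex R) v = z%:C *: map_mx (real_complex R) v.
Proof.
move=> Mv; rewrite -map_mxZ -Mv map_mxM; congr (_ *m _).
by apply/matrixP => i j; rewrite !mxE rmorph_int.
Qed.

Let eigenvalues := [:: alpha%:C; beta; conjc beta].

Lemma beta_neq_real (r : R) : beta != r%:C.
Proof. by apply: contra beta_nonreal => /eqP ->; rewrite conjc_real. Qed.

Lemma conj_beta_neq_real (r : R) : conjc beta != r%:C.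
Proof.
by apply: contra (beta_neq_real r) => /eqP h; rewrite -[beta]conjcK h conjc_real.
Qed.

Lemma eigenvalues_roots : all (root (char_poly N)) eigenvalues.
Proof.
rewrite /= andbT; apply/and3P; split.
- apply: (root_char_eigen _ (eigen_complex a_eigen)).
  by rewrite map_mx_eq0.
- exact: root_char_eigen b_neq0 b_eigen.
- by apply: (root_char_eigen _ eigen_conj); rewrite map_mx_eq0.
Qed.

Lemma eigenvalues_uniq : uniq eigenvalues.
Proof.
rewrite /= !inE negb_or andbT beta_nonreal andbT.
by rewrite eq_sym beta_neq_real eq_sym conj_beta_neq_real.
Qed.


(** The three distinct eigenvalues [alpha], [beta] and its conjugate exhaust the
    roots of the characteristic polynomial, and none of them is 1. *)
Lemma fixed_vector_eq0 (v : 'cV[R]_3) : map_mx intr M *m v = v -> v = 0.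
Proof.
move=> Mv; apply/eqP/negPn/negP => v0.
have r1 : root (char_poly N) 1.
  apply: (@root_char_eigen (map_mx (real_complex R) v)); first by rewrite map_mx_eq0.
  by rewrite (eigen_complex (z := 1)) ?scale1r.
have p0 : char_poly N != 0 by rewrite monic_neq0// char_poly_monic.
have all1 : all (root (char_poly N)) (1 :: eigenvalues) by rewrite /= r1; exact: eigenvalues_roots.
have uniq1 : uniq (1 :: eigenvalues).
  rewrite cons_uniq eigenvalues_uniq andbT !inE !negb_or; apply/and3P; split.
  - by apply/eqP => -[] h; move: alpha_gt1; rewrite -h ltxx.
  - by rewrite eq_sym -[1]/((1 : R)%:C) beta_neq_real.
  - by rewrite eq_sym -[1]/((1 : R)%:C) conj_beta_neq_real.
by have := max_poly_roots p0 all1 uniq1; rewrite size_char_poly.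
Qed.

(** The determinant is the product of the three eigenvalues. *)
Lemma eigen_product :
  alpha * (complex.Re beta ^+ 2 + complex.Im beta ^+ 2) = 1.
Proof.
have sN : size (char_poly N) = (size eigenvalues).+1 by rewrite size_char_poly.
have urs : uniq_roots eigenvalues by rewrite uniq_rootsE eigenvalues_uniq.
have := all_roots_prod_XsubC sN eigenvalues_roots urs.
rewrite (monicP (char_poly_monic _)) scale1r => /(congr1 (fun p : {poly R[i]} => p`_0)).
rewrite char_poly_det /N det_tr det_map_mx detM rmorph1 -horner_coef0.
rewrite !big_cons big_nil mulr1 !hornerE.
case: beta => p q /= /(congr1 (@complex.Re R)) /=.
by simpc => /= h; nra.
Qed.

Let X := map_mx (@complex.Re R) b.
Let Y := map_mx (@complex.Im R) b.
Let Mr : 'M[R]_3 := map_mx intr M.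

Lemma eigen_ReIm :
  Mr *m X = complex.Re beta *: X - complex.Im beta *: Y /\
  Mr *m Y = complex.Im beta *: X + complex.Re beta *: Y.
Proof.
have Mb (i : 'I_3) : \sum_j (M i j)%:~R * b j ord0 = beta * b i ord0.
  have := congr1 (fun A : 'cV_3 => A i ord0) b_eigen; rewrite !mxE => <-.
  by apply: eq_bigr => j _; rewrite mxE.
have int_complex (m : int) : (m%:~R : R[i]) = (m%:~R : R)%:C by rewrite rmorph_int.
split; apply/matrixP => i j; rewrite !mxE ord1; have := Mb i.
- move=> /(congr1 (@complex.Re R)); case: beta (b i ord0) => p q [u w] /= <-.
  rewrite raddf_sum; apply: eq_bigr => k _; rewrite !mxE int_complex.
  by case: (b k ord0) => u' w' /=; rewrite mul0r subr0.
- move=> /(congr1 (@complex.Im R)); case: beta (b i ord0) => p q [u w] /=.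
  rewrite addrC => <-; rewrite raddf_sum; apply: eq_bigr => k _.
  rewrite !mxE int_complex.
  by case: (b k ord0) => u' w' /=; rewrite mul0r addr0.
Qed.

(** Eigenvectors for distinct eigenvalues are independent, in real form:
    [(M - p) ^+ 2 + q ^+ 2] kills the plane of [X] and [Y] and acts on [a] as a
    nonzero scalar; inside that plane [M - p] acts as [q] times a rotation by a
    right angle. *)
Lemma eigen_independent (k0 k1 k2 : R) :
  k0 *: a + k1 *: X + k2 *: Y = 0 -> [/\ k0 = 0, k1 = 0 & k2 = 0].
Proof.
have [MX MY] := eigen_ReIm; set p := complex.Re beta in MX MY.
set q := complex.Im beta in MX MY => h0.
have q0 : q != 0.
  apply: contraNneq beta_nonreal => q0; move: q0; rewrite /q.
  by case: beta => p' q' /= ->; rewrite oppr0.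
have step (l0 l1 l2 : R) : l0 *: a + l1 *: X + l2 *: Y = 0 ->
    (alpha * l0) *: a + (p * l1 + q * l2) *: X + (p * l2 - q * l1) *: Y = 0.
  move=> /(congr1 (fun v => Mr *m v)); rewrite mulmx0 !mulmxDr -!scalemxAr.
  rewrite a_eigen MX MY => <-; apply/matrixP => i j; rewrite !mxE; ring.
have h1 := step _ _ _ h0; have h2 := step _ _ _ h1.
have coord (l0 l1 l2 : R) (i : 'I_3) : l0 *: a + l1 *: X + l2 *: Y = 0 ->
    l0 * a i ord0 + l1 * X i ord0 + l2 * Y i ord0 = 0.
  by move=> /(congr1 (fun A : 'cV_3 => A i ord0)); rewrite !mxE.
have qq : (alpha - p) ^+ 2 + q ^+ 2 != 0.
  by rewrite paddr_eq0 ?sqr_ge0// !sqrf_eq0 negb_and q0 orbT.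
have k00 : k0 = 0.
  apply/eqP/negPn/negP => k00.
  case/negP: a_neq0; apply/eqP/matrixP => i j; rewrite ord1 mxE.
  have e : ((alpha - p) ^+ 2 + q ^+ 2) * (k0 * a i ord0) = 0.
    have := coord _ _ _ i h0; have := coord _ _ _ i h1; have := coord _ _ _ i h2.
    set A := a i ord0; set B := X i ord0; set C := Y i ord0 => e2 e1 e0.
    transitivity ((alpha * (alpha * k0)) * A +
      (p * (p * k1 + q * k2) + q * (p * k2 - q * k1)) * B +
      (p * (p * k2 - q * k1) - q * (p * k1 + q * k2)) * C
      - 2 * p * (alpha * k0 * A + (p * k1 + q * k2) * B + (p * k2 - q * k1) * C)
      + (p ^+ 2 + q ^+ 2) * (k0 * A + k1 * B + k2 * C)); first by ring.
    by rewrite e2 e1 e0; ring.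
  by move/eqP: e; rewrite mulf_eq0 (negPf qq) mulf_eq0 (negPf k00) /= => /eqP.
split=> //; apply/eqP/negPn/negP => kn;
  (have kk : k1 ^+ 2 + k2 ^+ 2 != 0
    by rewrite paddr_eq0 ?sqr_ge0// !sqrf_eq0 negb_and kn ?orbT);
  case/negP: b_neq0; apply/eqP/matrixP => i j; rewrite ord1 mxE;
  (have := coord _ _ _ i h0; have := coord _ _ _ i h1; rewrite k00 !mxE);
  case: (b i ord0) => u w /= e1 e0;
  (have e3 : k2 * u - k1 * w = 0
    by apply: (mulfI q0); rewrite mulr0; transitivity
      ((alpha * 0 * a i ord0 + (p * k1 + q * k2) * u + (p * k2 - q * k1) * w) -
       p * (0 * a i ord0 + k1 * u + k2 * w)); [ring|rewrite e0 e1; ring]);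
  (have -> : u = 0 by apply: (mulfI kk); rewrite mulr0;
     transitivity (k1 * (0 * a i ord0 + k1 * u + k2 * w) + k2 * (k2 * u - k1 * w));
     [ring|rewrite e0 e3; ring]);
  (have -> // : w = 0 by apply: (mulfI kk); rewrite mulr0;
     transitivity (k2 * (0 * a i ord0 + k1 * u + k2 * w) - k1 * (k2 * u - k1 * w));
     [ring|rewrite e0 e3; ring]).
Qed.

(** Hence the translations of the group span a full lattice of [R * C]. *)
Lemma eigen_span (y : R) (z : R[i]) : exists c : 'I_3 -> R,
  \sum_i c i * a i ord0 = y /\ \sum_i (c i)%:C * b i ord0 = z.
Proof.
pose row0 (i : 'I_3) := nth 0 [:: a i ord0; X i ord0; Y i ord0].
pose Q : 'M[R]_3 := \matrix_(j, i) row0 i j.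
have QU : Q \in unitmx.
  rewrite -row_free_unit -kermx_eq0; apply/rowV0P => k /sub_kermxP kQ.
  pose i1 : 'I_3 := lift ord0 ord0; pose i2 : 'I_3 := lift ord0 (lift ord0 ord0).
  have h : k ord0 ord0 *: a + k ord0 i1 *: X + k ord0 i2 *: Y = 0.
    apply/matrixP => i j.
    have := congr1 (fun A : 'rV_3 => A ord0 i) kQ.
    by rewrite !mxE !big_ord_recl big_ord0 !mxE /row0 /= !mxE addr0 addrA (ord1 j).
  have [e0 e1 e2] := eigen_independent h.
  apply/rowP => -[[|[|[|]]]// hj]; rewrite !mxE.
  - by rewrite (_ : Ordinal hj = ord0) ?e0//; exact: val_inj.
  - by rewrite (_ : Ordinal hj = i1) ?e1//; exact: val_inj.
  - by rewrite (_ : Ordinal hj = i2) ?e2//; exact: val_inj.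
pose t : 'rV[R]_3 := \row_j nth 0 [:: y; complex.Re z; complex.Im z] j.
pose c := t *m invmx Q^T.
have cQ : c *m Q^T = t by rewrite mulmxKV// unitmx_tr.
have cE (j : 'I_3) : \sum_i c ord0 i * row0 i j = nth 0 [:: y; complex.Re z; complex.Im z] j.
  have := congr1 (fun A : 'rV_3 => A ord0 j) cQ; rewrite !mxE => <-.
  by apply: eq_bigr => i _; rewrite !mxE.
exists (c ord0); split; first exact: cE ord0.
have := cE (lift ord0 ord0); have := cE (lift ord0 (lift ord0 ord0)).
rewrite /row0 /= => e2 e1; apply/eqP; rewrite eq_complex !raddf_sum -e1 -e2.
apply/andP; split; apply/eqP; apply: eq_bigr => i _; rewrite !mxE;
  case: (b i ord0) => u w /=; ring.
Qed.

End Eigen.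

(** * Flat line bundles and nowhere zero sections *)

Lemma derive_expR_comp (R : realType) (V : normedModType R) (f : V -> R) (x v : V) :
  differentiable f x -> differentiable (expR \o f) x /\
  'D_v (expR \o f) x = expR (f x) * 'D_v f x.
Proof.
move=> df; have de : differentiable (@expR R) (f x).
  by apply/derivable1_diffP.
split; first exact: differentiable_comp.
rewrite deriveE; last exact: differentiable_comp.
rewrite diff_comp//= diff1E// deriveE// mulrC; congr (_ * _).
by rewrite derive1E derive_val.
Qed.

Section Quotient.
Context (R : realType) (G : set (C2 R -> C2 R)).
Local Notation q := (orbit_of G).
Implicit Types (x y v : C2 R) (W : set (set (C2 R))) (f : set (C2 R) -> R).

Lemma quot_orbit x : HxC x -> quot G (q x).
Proof. by move=> Hx; exists x. Qed.

Lemma quot_open_near W x : quot_open G W -> HxC x -> W (q x) ->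
  \forall y \near x, W (q y).
Proof.
move=> [_ oW] Hx Wx; have : nbhs x (@HxC R `&` q @^-1` W) by exact: open_nbhs_nbhs.
by apply: filterS => y [].
Qed.

Lemma locally_constant_near W f x : locally_constant G W f -> HxC x -> W (q x) ->
  (\forall y \near x, W (q y)) -> \forall y \near x, f (q y) = f (q x).
Proof.
move=> lc Hx Wx nW; have [N [oN Nx NW]] := lc _ Wx.
by apply: filterS2 (quot_open_near oN Hx Nx) nW => y Ny Wy; exact: NW.
Qed.

Lemma quot_openI_open W1 W2 : quot_open G W1 -> quot_open G W2 ->
  open (@HxC R `&` q @^-1` (W1 `&` W2)).
Proof.
move=> [_ o1] [_ o2].
suff -> : @HxC R `&` q @^-1` (W1 `&` W2) =
   (@HxC R `&` q @^-1` W1) `&` (@HxC R `&` q @^-1` W2) by exact: openI.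
by rewrite preimage_setI setIACA setIid.
Qed.

Lemma locally_constant_smooth W1 W2 f : quot_open G W1 -> quot_open G W2 ->
  locally_constant G (W1 `&` W2) f -> quot_smooth G (W1 `&` W2) f.
Proof.
move=> o1 o2 lc; apply: (near_const_smooth (quot_openI_open o1 o2)) => x [Hx [W1x W2x]].
apply: (locally_constant_near lc Hx) => //.
apply: filterS2 (quot_open_near o1 Hx W1x) (quot_open_near o2 Hx W2x).
by move=> y ? ?; split.
Qed.

Section Deformation.
Context (L L' : bundle R) (theta : tensor1 R)
  (t : bidx L -> bidx L' -> set (C2 R) -> R).
Hypotheses (fL' : flat_bundle G L') (iso_t : bundle_iso (L' := L') (L := L) t)
  (smooth_t : forall i a, quot_smooth G (bcover i `&` bcover a) (t i a)).
Hypothesis twist : forall W sigma' sigma, quot_open G W ->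
  @bundle_section R G L' W sigma' -> @bundle_section R G L W sigma ->
  (forall i a p, W p -> bcover i p -> bcover a p ->
     sigma i p = t i a p * sigma' a p) ->
  flat_section G W sigma' <-> twisted_closed G theta W sigma.

(** Over [bcover a] the bundle [L'] has a flat frame, with components
    [btrans b a]; column [a] of [t] is the section of [L] that it is mapped
    to. *)
Lemma iso_twisted_closed k a x v : HxC x -> bcover k (q x) -> bcover a (q x) ->
  quot_d G (t k a) x v + theta x v * t k a (q x) = 0.
Proof.
move=> Hx kx ax; have [[oU _] lc _ coc] := fL'; have [_ t2 t3] := iso_t.
have sec' : bundle_section G (bcover a) (fun b => btrans b a).
  split=> [b|i j p ap ip jp]; last by rewrite coc.
  by rewrite setIC; apply: locally_constant_smooth.
have sec : bundle_section G (bcover a) (fun k => t k a).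
  split=> [b|i j p ap ip jp]; last by rewrite t2.
  by rewrite setIC; apply: smooth_t.
have rel i b p : bcover a p -> bcover i p -> bcover b p ->
    t i a p = t i b p * btrans b a p by move=> ap ip bp; rewrite t3.
have [H _] := twist (oU a) sec' sec rel.
apply: (H _ k x Hx) => // i.
by rewrite setIC; exact: lc.
Qed.

End Deformation.

Section Ratio.
Context (L L' : bundle R) (t : bidx L -> bidx L' -> set (C2 R) -> R)
  (psi theta theta' : tensor1 R).
Context (I I' : Type) (U : I -> set (set (C2 R))) (U' : I' -> set (set (C2 R)))
  (f : I -> set (C2 R) -> R) (f' : I' -> set (C2 R) -> R)
  (r : bidx L -> I -> set (C2 R) -> R) (r' : bidx L' -> I' -> set (C2 R) -> R).
Hypotheses (oL : open_cover G (@bcover R L)) (oL' : open_cover G (@bcover R L'))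
  (oU : open_cover G U) (oU' : open_cover G U')
  (iso_t : bundle_iso (L' := L') (L := L) t)
  (smooth_t : forall k a, quot_smooth G (bcover k `&` bcover a) (t k a))
  (closed_t : forall k a x v, HxC x -> bcover k (q x) -> bcover a (q x) ->
    quot_d G (t k a) x v + psi x v * t k a (q x) = 0)
  (smooth_f : forall i, quot_smooth G (U i) (f i))
  (smooth_f' : forall i, quot_smooth G (U' i) (f' i))
  (df : forall i x, HxC x -> U i (q x) -> forall v, quot_d G (f i) x v = theta x v)
  (df' : forall i x, HxC x -> U' i (q x) -> forall v,
    quot_d G (f' i) x v = theta' x v)
  (iso_r : bundle_iso (L' := Bundle U (fun i j p => expR (- (f i p - f j p))))
     (L := L) r)
  (iso_r' : bundle_iso (L' := Bundle U' (fun i j p => expR (- (f' i p - f' j p))))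
     (L := L') r')
  (lc_r : forall k j, locally_constant G (bcover k `&` U j) (r k j))
  (lc_r' : forall a i, locally_constant G (bcover a `&` U' i) (r' a i)).

(* In L the functions expR (- f j) define a nowhere zero global section, and
   likewise expR (- f' i) in L'; ratio is the quotient of the image under t of
   the latter by the former, written in local trivializations. *)
Let ratio k j a i p := t k a p * (r' a i p * expR (- f' i p)) /
  (r k j p * expR (- f j p)).

Let ratio_indep k j a i k2 j2 a2 i2 p :
  bcover k p -> U j p -> bcover a p -> U' i p ->
  bcover k2 p -> U j2 p -> bcover a2 p -> U' i2 p ->
  ratio k j a i p = ratio k2 j2 a2 i2 p.
Proof.
move=> kp jp ap ip k2p j2p a2p i2p.
have [t1 t2 t3] := iso_t; have [r1 r2 r3] := iso_r; have [r1' r2' r3'] := iso_r'.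
have expE (g1 g2 : R) : expR (- (g1 - g2)) * expR (- g2) = expR (- g1).
  by rewrite -expRD; congr expR; ring.
have -> : ratio k2 j2 a2 i2 p = ratio k2 j2 a2 i p.
  rewrite /ratio; congr (_ * _ / _).
  by rewrite -[LHS]/(_ * _) -(r3' a2 i i2 p)//= -mulrA expE.
have -> : ratio k2 j2 a2 i p = ratio k2 j a2 i p.
  rewrite /ratio; congr (_ / _).
  by rewrite -(r3 k2 j j2 p)//= -mulrA expE.
have -> : ratio k2 j a2 i p = ratio k2 j a i p.
  by rewrite /ratio -(t3 k2 a a2 p)// -(r2' a a2 i p)//; congr (_ / _); ring.
have tn := t1 k a p kp ap; rewrite -(t2 k k2 a p)// mulf_eq0 negb_or in tn.
have [bn _] := andP tn; rewrite /ratio -(t2 k k2 a p)// -(r2 k k2 j p)//.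
have cancel (g A B C D : R) : g != 0 -> g * A * B / (g * C * D) = A * B / (C * D).
  by move=> g0; rewrite -(mulrA g A) -(mulrA g C) -mulf_div divff// mul1r.
exact: cancel.
Qed.

(** The logarithmic derivative of that quotient compares the three forms on the
    quotient space: [theta - theta' - psi] is exact, with an invariant potential
    [ln kappa]. The absolute value is taken because isomorphisms of real line
    bundles may be negative in some trivializations. *)
Lemma ratio_potential : exists2 kappa : set (C2 R) -> R,
  (forall x, HxC x -> 0 < kappa (q x)) &
  forall x, HxC x -> differentiable (kappa \o q) x /\
    forall v, 'D_v (kappa \o q) x =
      kappa (q x) * (theta x v - theta' x v - psi x v).
Proof.
have ex p : exists c : R, forall k j a i,
    bcover k p -> U j p -> bcover a p -> U' i p -> c = `|ratio k j a i p|.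
  have [[k [j [a [i [kp jp ap ip]]]]]|none] := pselect (exists (k : bidx L) j (a : bidx L') i,
      [/\ bcover k p, U j p, bcover a p & U' i p]).
    exists `|ratio k j a i p| => k2 j2 a2 i2 k2p j2p a2p i2p.
    by rewrite (@ratio_indep k j a i k2 j2 a2 i2).
  by exists 0 => k j a i kp jp ap ip; case: none; exists k, j, a, i.
have [kappa kE] := choice ex.
have [t1 _ _] := iso_t; have [r1 _ _] := iso_r; have [r1' _ _] := iso_r'.
have idx x : HxC x -> exists (k : bidx L) j (a : bidx L') i,
    [/\ bcover k (q x), U j (q x), bcover a (q x) & U' i (q x)].
  move=> /quot_orbit Qx.
  have [k ?] := oL.2 _ Qx; have [j ?] := oU.2 _ Qx.
  have [a ?] := oL'.2 _ Qx; have [i ?] := oU'.2 _ Qx.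
  by exists k, j, a, i.
exists kappa.
  move=> x Hx; have [k [j [a [i [kx jx ax ix]]]]] := idx _ Hx.
  rewrite (kE _ k j a i)// normr_gt0 /ratio !mulf_neq0 ?invr_eq0 ?mulf_neq0//.
  - exact: t1.
  - exact: r1'.
  - by rewrite gt_eqF ?expR_gt0.
  - exact: r1.
  - by rewrite gt_eqF ?expR_gt0.
move=> x Hx; have [k [j [a [i [kx jx ax ix]]]]] := idx _ Hx.
pose T := t k a \o q; pose phi y := f j (q y) - f' i (q y).
have dT : differentiable T x by 
  exact: (smooth_differentiable (@smooth_t k a) (conj Hx (conj kx ax))).
have dfj : differentiable (f j \o q) x by 
  exact: (smooth_differentiable (@smooth_f j) (conj Hx jx)).
have dfi : differentiable (f' i \o q) x by 
  exact: (smooth_differentiable (@smooth_f' i) (conj Hx ix)).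
have dphi : differentiable phi x by exact: differentiableB.
have nk := quot_open_near (oL.1 k) Hx kx; have nj := quot_open_near (oU.1 j) Hx jx.
have na := quot_open_near (oL'.1 a) Hx ax; have ni := quot_open_near (oU'.1 i) Hx ix.
have nr : \forall y \near x, r k j (q y) = r k j (q x).
  exact: (locally_constant_near (@lc_r k j) Hx (conj kx jx) (filterI nk nj)).
have nr' : \forall y \near x, r' a i (q y) = r' a i (q x).
  exact: (locally_constant_near (@lc_r' a i) Hx (conj ax ix) (filterI na ni)).
have T0 : T x != 0 by exact: t1.
have nT : \forall y \near x, `|T y| = Num.sg (T x) * T y.
  have cT := differentiable_continuous dT.
  have [Tp|Tn|/eqP] := ltrgtP (T x) 0; last by rewrite (negPf T0).
  - near=> y; have Ty : T y < 0 by near: y; exact: (cvgr_lt (T x) cT 0 Tp).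
    by rewrite ltr0_norm// ltr0_sg// mulN1r.
  - near=> y; have Ty : 0 < T y by near: y; exact: (cvgr_gt (T x) cT 0 Tn).
    by rewrite gtr0_norm// gtr0_sg// mul1r.
pose c := `|r' a i (q x) / r k j (q x)| * Num.sg (T x).
have nE : \forall y \near x, c * (T y * expR (phi y)) = kappa (q y).
  near=> y; rewrite (kE _ k j a i); [|by near: y..].
  rewrite /ratio !normrM normfV normrM.
  have -> : `|t k a (q y)| = Num.sg (T x) * T y by near: y.
  have -> : r' a i (q y) = r' a i (q x) by near: y.
  have -> : r k j (q y) = r k j (q x) by near: y.
  rewrite /c normrM normfV !(ger0_norm (expR_ge0 _)) invfM -expRN opprK.
  by rewrite /phi expRD; ring.
have [de De] : differentiable (expR \o phi) x /\
    forall v, 'D_v (expR \o phi) x = expR (phi x) * 'D_v phi x.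
  by split=> [|v]; [have [] := derive_expR_comp 0 dphi|have [] := derive_expR_comp v dphi].
have dTe : differentiable (T * (expR \o phi)) x by exact: differentiableM.
split.
  apply: near_eq_differentiable nE _.
  exact: (differentiableZ c dTe).
move=> v; rewrite -(near_eq_derive v nE).
rewrite (deriveZ (f := T * (expR \o phi)) c); last exact: diff_derivable.
rewrite deriveM; [|exact: diff_derivable..].
rewrite De deriveB; [|exact: diff_derivable..].
rewrite -(nbhs_singleton nE).
have -> : 'D_v (f j \o q) x = theta x v by exact: df.
have -> : 'D_v (f' i \o q) x = theta' x v by exact: df'.
have -> : 'D_v T x = - (psi x v * T x).
  by apply/eqP; rewrite -addr_eq0; apply/eqP; exact: closed_t.
by rewrite /= /GRing.scale /=; ring.
Unshelve. all: by end_near. Qed.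

End Ratio.
End Quotient.

(** * The half space and the Lee form of the Inoue metric *)

Lemma derive_affine_map (R : realType) (V W : normedModType R) (p : V -> W)
    (x v : V) (w : W) :
  (forall h : R, p (h *: v + x) = h *: w + p x) -> 'D_v p x = w.
Proof.
move=> pE; apply: cvg_lim => //.
suff e : \forall h \near (0 : R)^', w = h^-1 *: (p (h *: v + x) - p x).
  by apply: cvg_trans (near_eq_cvg e) _; exact: cvg_cst.
near=> h; have h0 : h != 0 by near: h; exact: nbhs_dnbhs_neq.
by rewrite pE addrK scalerA mulVf ?scale1r.
Unshelve. all: by end_near. Qed.

Section HalfSpace.
Context (R : realType).
Implicit Types (x y v : C2 R).

Lemma open_HxC : open (@HxC R).
Proof.
have c : continuous (fun x : C2 R => x.1.2).
  exact: (@coord_continuous R (Ordinal (isT : (1 < 4)%N))).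
exact: (open_comp (fun x _ => c x) (@open_gt R 0)).
Qed.

Lemma HxC_segment x y (t : R) : HxC x -> HxC y -> t \in `[0, 1] ->
  HxC (t *: (x - y) + y).
Proof.
rewrite in_itv/= => x0 y0 /andP[t0 t1].
rewrite /HxC /= -[_ *: _]/(t * (x.1.2 - y.1.2)).
have -> : t * (x.1.2 - y.1.2) + y.1.2 = t * x.1.2 + (1 - t) * y.1.2 by ring.
move: t0; rewrite le_eqVlt => /predU1P[<-|t0].
  by rewrite mul0r add0r subr0 mul1r.
by rewrite ltr_wpDr ?mulr_gt0// mulr_ge0 ?subr_ge0// ltW.
Qed.

Lemma HxC_stable v : v.1.2 = 0 -> stable (@HxC R) v.
Proof.
by move=> v0 x Hx t; rewrite /HxC /= -[_ *: _]/(t * v.1.2) v0 mulr0 add0r.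
Qed.

(** The half space is convex. *)
Lemma HxC_constant (g : C2 R -> R) x y :
  (forall z v, HxC z -> is_derive z v g 0) -> HxC x -> HxC y -> g x = g y.
Proof.
move=> dg Hx Hy; have [|s s01] := @MVT_line R _ g y (x - y).
  by move=> s s01; have [] := dg _ (x - y) (HxC_segment Hx Hy s01).
rewrite subrK; have [_ ->] := dg _ (x - y) (HxC_segment Hx Hy s01).
by move/eqP; rewrite subr_eq0 => /eqP.
Qed.

Definition e_w1 : C2 R := ((1, 0), (0, 0)).
Definition e_w2 : C2 R := ((0, 1), (0, 0)).
Definition e_z1 : C2 R := ((0, 0), (1, 0)).
Definition e_z2 : C2 R := ((0, 0), (0, 1)).

Lemma Jmul_z1 : Jmul e_z1 = e_z2.
Proof. by rewrite /Jmul /mkC2 /e_z1 /e_z2 /wcoord /zcoord /=; simpc. Qed.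

Lemma Jmul_z2 : Jmul e_z2 = - e_z1.
Proof.
rewrite /Jmul /mkC2 /e_z1 /e_z2 /wcoord /zcoord /=; simpc => /=.
by rewrite -[- ((0, 0), _)]/((- 0, - 0), (- 1, - 0)) !oppr0.
Qed.

(** Wedging a 1-form with a nondegenerate 2-form is injective in complex
    dimension two, so the Lee form is determined by [inoue_omega]. *)
Lemma lee_form_inoue (G : set (C2 R -> C2 R)) theta x v :
  lee_form G (@inoue_omega R) theta -> HxC x -> theta x v = v.1.2 / x.1.2.
Proof.
move=> [[[_ lin _] _] lee] Hx; have x0 : x.1.2 != 0 by rewrite gt_eqF.
have oE y u t : inoue_omega y u t =
    2 * ((u.1.2 * t.1.1 - u.1.1 * t.1.2) / y.1.2 ^+ 2
         + y.1.2 * (u.2.2 * t.2.1 - u.2.1 * t.2.2)).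
  rewrite inoue_omegaE /fundamental_form /inoue_metric /Jmul /mkC2 /wcoord /zcoord /=.
  by simpc => /=; ring.
have D0 u t w : w.1.2 = 0 -> 'D_w (fun y => inoue_omega y u t) x = 0.
  move=> w0; rewrite (@derive_affine_map _ _ _ _ x w (0 : R))// => h.
  by rewrite scaler0 add0r !oE /= -[_ *: _]/(h * w.1.2) w0 mulr0 add0r.
have Dc u t w : (forall y, inoue_omega y u t = 0) ->
    'D_w (fun y => inoue_omega y u t) x = 0.
  by move=> o0; rewrite (_ : (fun y => _) = cst 0) ?derive_cst//; apply/funext.
have Dz : 'D_e_w2 (fun y => inoue_omega y e_z1 e_z2) x = - 2.
  by apply: derive_affine_map => h; rewrite !oE /= /GRing.scale /=; ring.
have o12 y : inoue_omega y e_w1 e_w2 = - 2 / y.1.2 ^+ 2 by rewrite oE /=; ring.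
have o34 y : inoue_omega y e_z1 e_z2 = - 2 * y.1.2 by rewrite oE /=; ring.
have o13 y : inoue_omega y e_w1 e_z1 = 0 by rewrite oE /=; ring.
have o14 y : inoue_omega y e_w1 e_z2 = 0 by rewrite oE /=; ring.
have o23 y : inoue_omega y e_w2 e_z1 = 0 by rewrite oE /=; ring.
have o24 y : inoue_omega y e_w2 e_z2 = 0 by rewrite oE /=; ring.
have o31 y : inoue_omega y e_z1 e_w1 = 0 by rewrite oE /=; ring.
have o32 y : inoue_omega y e_z1 e_w2 = 0 by rewrite oE /=; ring.
have o41 y : inoue_omega y e_z2 e_w1 = 0 by rewrite oE /=; ring.
have o42 y : inoue_omega y e_z2 e_w2 = 0 by rewrite oE /=; ring.
have two0 : (2 : R) != 0 by rewrite pnatr_eq0.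
have c34 : - 2 * x.1.2 != 0 by rewrite mulf_neq0// oppr_eq0.
have c12 : - 2 / x.1.2 ^+ 2 != 0 by rewrite mulf_neq0 ?oppr_eq0// invr_eq0 expf_eq0.
have z1 : theta x e_w1 = 0.
  have := lee x Hx e_w1 e_z1 e_z2; rewrite /ext_d2 /wedge12 D0// !Dc// o34 o14 o13.
  by rewrite !mulr0 !subr0 !addr0 => /esym/eqP; rewrite mulf_eq0 (negPf c34) orbF => /eqP.
have z2 : theta x e_w2 = x.1.2^-1.
  have := lee x Hx e_w2 e_z1 e_z2; rewrite /ext_d2 /wedge12 Dz !Dc// o34 o24 o23.
  rewrite !mulr0 !subr0 !addr0 => e; apply: (mulIf c34); rewrite -e; field.
  exact: x0.
have z3 : theta x e_z1 = 0.
  have := lee x Hx e_z1 e_w1 e_w2; rewrite /ext_d2 /wedge12 D0// !Dc// o12 o31 o32.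
  by rewrite !mulr0 !subr0 !addr0 => /esym/eqP; rewrite mulf_eq0 (negPf c12) orbF => /eqP.
have z4 : theta x e_z2 = 0.
  have := lee x Hx e_z2 e_w1 e_w2; rewrite /ext_d2 /wedge12 D0// !Dc// o12 o41 o42.
  by rewrite !mulr0 !subr0 !addr0 => /esym/eqP; rewrite mulf_eq0 (negPf c12) orbF => /eqP.
have lt : linear_on (@HxC R) theta by [].
have eb i : basis_vec R i = nth 0 [:: e_w1; e_w2; e_z1; e_z2] i.
  by case: i => -[|[|[|[|]]]].
rewrite (linear_on_coord v lt Hx) !big_ord_recl big_ord0 !eb /= z1 z2 z3 z4.
by rewrite /coord /=; ring.
Qed.

End HalfSpace.

(** * The lattice and the dilation *)

(** Bernoulli's inequality and the Archimedean property. *)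
Lemma expr_bounded_le1 (R : archiRealFieldType) (r C : R) : 0 < r ->
  (forall n, r ^+ n <= C) -> r <= 1.
Proof.
move=> r0 rC; rewrite leNgt; apply/negP => r1.
have bern n : 1 + n%:R * (r - 1) <= r ^+ n.
  elim: n => [|n IH]; first by rewrite mul0r addr0 expr0.
  rewrite exprS; apply: le_trans (ler_wpM2l (ltW r0) IH).
  have := sqr_ge0 (r - 1); have : 0 <= n%:R :> R by [].
  by rewrite -natr1 => ? ?; nra.
have d0 : 0 < r - 1 by rewrite subr_gt0.
have := le_trans (bern (Num.bound (C / (r - 1)))) (rC _).
have C0 : 0 <= C by apply: le_trans (rC 0%N); rewrite expr0.
have := archi_boundP (divr_ge0 C0 (ltW d0)).
by rewrite ltr_pdivrMr// => h1 h2; lra.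
Qed.

Section InoueGroup.
Context (R : realType) (M : 'M[int]_3) (alpha : R) (beta : R[i])
  (a : 'cV[R]_3) (b : 'cV[R[i]]_3).
Hypotheses (alpha_gt1 : 1 < alpha)
  (beta_nonreal : beta != conjc beta) (a_neq0 : a != 0) (b_neq0 : b != 0)
  (a_eigen : map_mx intr M *m a = alpha *: a)
  (b_eigen : map_mx intr M *m b = beta *: b).
Local Notation G := (inoue_group alpha beta a b).
Local Notation dil := (phi0 alpha beta).
Implicit Types (x y v : C2 R).

Let alpha0 : 0 < alpha. Proof. exact: lt_trans alpha_gt1. Qed.

Let beta0 : beta != 0.
Proof. by apply: contraNneq beta_nonreal => ->; rewrite conjc0. Qed.

Definition period (i : 'I_3) : C2 R :=
  ((a i ord0, 0), (complex.Re (b i ord0), complex.Im (b i ord0))).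

Lemma phiE i x : phi a b i x = period i + x.
Proof.
case: x => -[w1 w2] [z1 z2]; rewrite /phi /mkC2 /wcoord /zcoord /period /=.
case: (b i ord0) => p q /=.
by congr ((_, _), (_, _)); rewrite /= ?addr0 ?add0r// addrC.
Qed.

Lemma dil_coord x : dil x = ((alpha * x.1.1, alpha * x.1.2),
  (complex.Re beta * x.2.1 - complex.Im beta * x.2.2,
   complex.Re beta * x.2.2 + complex.Im beta * x.2.1)).
Proof.
rewrite /phi0 /mkC2 /wcoord /zcoord; case: beta => p q /=.
by rewrite !mul0r subr0 addr0.
Qed.

Lemma dil_linear (h : R) v x : dil (h *: v + x) = h *: dil v + dil x.
Proof.
rewrite !dil_coord; case: v => -[v1 v2] [v3 v4]; case: x => -[x1 x2] [x3 x4] /=.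
by congr ((_, _), (_, _)); rewrite /= /GRing.scale /=; ring.
Qed.

Lemma HxC_phi i x : HxC (phi a b i x) <-> HxC x.
Proof. by rewrite phiE /HxC /= add0r. Qed.

Lemma HxC_dil x : HxC (dil x) <-> HxC x.
Proof. by rewrite dil_coord /HxC /= pmulr_rgt0. Qed.

Lemma G_phi i : G (phi a b i).
Proof. by apply: gen_mem; right; exists i. Qed.

Lemma G_dil : G dil.
Proof. by apply: gen_mem; left. Qed.

Definition dil_inv x : C2 R :=
  mkC2 ((alpha^-1)%:C%C * wcoord x) (beta^-1 * zcoord x).

Lemma wcoord_mkC2 (w z : R[i]) : wcoord (mkC2 w z) = w.
Proof. by case: w. Qed.

Lemma zcoord_mkC2 (w z : R[i]) : zcoord (mkC2 w z) = z.
Proof. by case: z. Qed.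

Lemma mkC2_coord x : mkC2 (wcoord x) (zcoord x) = x.
Proof. by case: x => -[? ?] [? ?]. Qed.

Lemma dil_invK : cancel dil_inv dil.
Proof.
move=> x; rewrite /phi0 /dil_inv wcoord_mkC2 zcoord_mkC2 !mulrA.
by rewrite -rmorphM mulfV ?gt_eqF// rmorph1 mulfV// !mul1r mkC2_coord.
Qed.

Lemma dilK : cancel dil dil_inv.
Proof.
move=> x; rewrite /phi0 /dil_inv wcoord_mkC2 zcoord_mkC2 !mulrA.
by rewrite -rmorphM mulVf ?gt_eqF// rmorph1 mulVf// !mul1r mkC2_coord.
Qed.

Lemma G_dil_inv : G dil_inv.
Proof. exact: gen_inv G_dil dilK dil_invK. Qed.

Lemma orbit_invariant g g' x : G g -> G g' -> cancel g g' ->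
  orbit_of G (g x) = orbit_of G x.
Proof.
move=> Gg Gg' gK; apply/seteqP; split=> y [k Gk ->].
  by exists (k \o g) => //; exact: gen_comp.
by exists (k \o g'); [exact: gen_comp|rewrite /= gK].
Qed.

Lemma orbit_dil x : orbit_of G (dil x) = orbit_of G x.
Proof. exact: orbit_invariant G_dil G_dil_inv dilK. Qed.

Lemma orbit_phi i x : orbit_of G (phi a b i x) = orbit_of G x.
Proof.
pose g' y := - period i + y; have pK : cancel (phi a b i) g'.
  by move=> y; rewrite phiE /g' addKr.
have Kp : cancel g' (phi a b i) by move=> y; rewrite phiE /g' addNKr.
exact: orbit_invariant (G_phi i) (gen_inv (G_phi i) pK Kp) pK.
Qed.

Lemma derive_phi i x v : 'D_v (phi a b i) x = v.
Proof. by apply: derive_affine_map => h; rewrite !phiE addrCA. Qed.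

Lemma derive_dil x v : 'D_v dil x = dil v.
Proof. by apply: derive_affine_map => h; rewrite dil_linear. Qed.

Lemma period_stable i : stable (@HxC R) (period i).
Proof. exact: HxC_stable. Qed.

(** The dilation normalizes the lattice of translations, through [M]. *)
Lemma dil_period i : dil (period i) = \sum_j (M i j)%:~R *: period j.
Proof.
have Ma : alpha * a i ord0 = \sum_j (M i j)%:~R * a j ord0.
  have := congr1 (fun A : 'cV_3 => A i ord0) a_eigen; rewrite !mxE => <-.
  by apply: eq_bigr => j _; rewrite mxE.
have Mb : beta * b i ord0 = \sum_j (M i j)%:~R * b j ord0.
  have := congr1 (fun A : 'cV_3 => A i ord0) b_eigen; rewrite !mxE => <-.
  by apply: eq_bigr => j _; rewrite mxE.
have -> : dil (period i) = mkC2 (alpha%:C%C * (a i ord0)%:C%C) (beta * b i ord0).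
  by rewrite /phi0 /period /zcoord; case: (b i ord0).
rewrite -rmorphM Ma Mb !big_ord_recl !big_ord0 !addr0.
have int_complex (m : int) : (m%:~R : R[i]) = (m%:~R : R)%:C%C by rewrite rmorph_int.
rewrite !int_complex /mkC2 /period.
case: (b ord0 ord0) => ? ?; case: (b (lift _ _) ord0) => ? ?.
case: (b (lift _ (lift _ _)) ord0) => ? ? /=.
by congr ((_, _), (_, _)); rewrite /= /GRing.scale /=; ring.
Qed.

Lemma periods_span (w : R) (z : R[i]) : exists c : 'I_3 -> R,
  ((w, 0), (complex.Re z, complex.Im z)) = \sum_i c i *: period i :> C2 R.
Proof.
have [c [<- <-]] := eigen_span beta_nonreal a_neq0 b_neq0 a_eigen b_eigen w z.
exists c; rewrite !big_ord_recl !big_ord0 !addr0 /period.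
case: (b ord0 ord0) => ? ?; case: (b (lift _ _) ord0) => ? ?.
case: (b (lift _ (lift _ _)) ord0) => ? ? /=.
by congr ((_, _), (_, _)); rewrite /= /GRing.scale /=; ring.
Qed.

Section Periods.
Variables (f : C2 R -> R) (rho : 'I_3 -> R).
Hypothesis f_period : forall i x, HxC x -> f (period i + x) = f x + rho i.

Lemma int_period i (m : int) x : HxC x ->
  f (m%:~R *: period i + x) = f x + m%:~R * rho i.
Proof.
have nat_period (n : nat) y : HxC y -> f (n%:R *: period i + y) = f y + n%:R * rho i.
  elim: n y => [|n IH] y Hy; first by rewrite scale0r add0r mul0r addr0.
  rewrite -[n.+1%:R]natr1 scalerDl scale1r [_ + period i]addrC -addrA f_period.
    by rewrite IH// mulrDl mul1r addrA.
  exact: period_stable.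
move=> Hx; case: m => n; first exact: nat_period.
rewrite NegzE mulrNz scaleNr mulNr -pmulrn.
apply/eqP; rewrite eq_sym subr_eq -(nat_period n.+1).
  by rewrite addrA subrr add0r.
by rewrite -scaleNr; exact: period_stable.
Qed.

Lemma lattice_period (m : 'I_3 -> int) x : HxC x ->
  f ((\sum_i (m i)%:~R *: period i) + x) = f x + \sum_i (m i)%:~R * rho i.
Proof.
elim: (index_enum _) x => [|i r IH] x Hx; first by rewrite !big_nil add0r addr0.
rewrite !big_cons [X in f (X + _)]addrC -addrA IH; last exact: period_stable.
by rewrite int_period// addrA.
Qed.

End Periods.
End InoueGroup.

(** * The homothety factor of the Kaehler covering *)

Section Factor.
Context (R : realType) (M : 'M[int]_3) (alpha : R) (beta : R[i])
  (a : 'cV[R]_3) (b : 'cV[R[i]]_3).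
Hypotheses (detM : \det M = 1) (alpha_gt1 : 1 < alpha)
  (beta_nonreal : beta != conjc beta) (a_neq0 : a != 0) (b_neq0 : b != 0)
  (a_eigen : map_mx intr M *m a = alpha *: a)
  (b_eigen : map_mx intr M *m b = beta *: b).
Local Notation G := (inoue_group alpha beta a b).
Local Notation dil := (phi0 alpha beta).
Local Notation period := (period a b).
Implicit Types (x y v : C2 R).

(** The slice [w_2 = 1] is a compact torus modulo the translations: it is enough
    to bound [f] on the image of a cube. *)
Lemma torus_bounds (f : C2 R -> R) : cont_on (@HxC R) f ->
  (forall i x, HxC x -> f (period i + x) = f x) ->
  (forall x, HxC x -> 0 < f x) ->
  exists m m' : R, 0 < m /\ forall x, x.1.2 = 1 -> m <= f x <= m'.
Proof.
move=> cf pf f0.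
pose psi (t : R * R * R) : C2 R := t.1.1 *: period ord0 +
  (t.1.2 *: period (lift ord0 ord0) +
   t.2 *: period (lift ord0 (lift ord0 ord0))) + e_w2 R.
have psi1 t : (psi t).1.2 = 1 by rewrite /= /GRing.scale /=; ring.
have psiH t : HxC (psi t).
  by have := @ltr01 R; rewrite -(psi1 t).
have psi_cont : continuous psi.
  move=> t; apply: cvgD; last exact: cvg_cst.
  have c1 : (s : R * R * R).1 @[s --> t] --> t.1 by exact: cvg_fst.
  have c2 : (s : R * R * R).2 @[s --> t] --> t.2 by exact: cvg_snd.
  have c11 : (s : R * R).1 @[s --> t.1] --> t.1.1 by exact: cvg_fst.
  have c12 : (s : R * R).2 @[s --> t.1] --> t.1.2 by exact: cvg_snd.
  apply: cvgD; first by apply: cvgZr_tmp; exact: (cvg_comp _ _ c1 c11).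
  by apply: cvgD; apply: cvgZr_tmp => //; exact: (cvg_comp _ _ c1 c12).
have fpsi_cont : continuous (f \o psi).
  by move=> t; exact: (cvg_comp _ _ (psi_cont t) (cf _ (psiH t))).
pose K : set (R * R * R) := (`[0, 1] `*` `[0, 1]) `*` `[0, 1].
have K0 : K !=set0.
  by exists (0, 0, 0); rewrite /K /= !in_itv /= lexx ler01.
have cK : compact K by do 2?apply: compact_setX; exact: segment_compact.
have cfK : {within K, continuous (f \o psi)} by exact: continuous_subspaceT.
have [tm _ fm] := compact_EVT_min K0 cK cfK.
have [tM _ fM] := compact_EVT_max K0 cK cfK.
exists (f (psi tm)), (f (psi tM)); split; first exact/f0/psiH.
move=> x x1.
have [c cE] := periods_span beta_nonreal a_neq0 b_neq0 a_eigen b_eigen x.1.1 (Complex x.2.1 x.2.2).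
(* Integer parts of the lattice coordinates move the point into the cube. *)
pose n i : int := Num.floor (c i).
pose t : R * R * R := (c ord0 - (n ord0)%:~R,
  c (lift ord0 ord0) - (n (lift ord0 ord0))%:~R,
  c (lift ord0 (lift ord0 ord0)) - (n (lift ord0 (lift ord0 ord0)))%:~R).
have xE : x = (\sum_i (n i)%:~R *: period i) + psi t.
  transitivity ((\sum_i c i *: period i) + e_w2 R).
    rewrite -cE /=; case: (x) x1 => -[w1 w2] [z1 z2] /= ->.
    by congr ((_, _), (_, _)); rewrite /= ?addr0 ?add0r.
  rewrite /psi !big_ord_recl !big_ord0 !addr0 /= !scalerBl.
  rewrite [RHS]addrA; congr (_ + _); rewrite [RHS]addrACA; congr (_ + _).
    by rewrite addrC subrK.
  by rewrite [RHS]addrACA; congr (_ + _); rewrite addrC subrK.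
have pf0 i y : HxC y -> f (period i + y) = f y + 0 by move=> /pf ->; rewrite addr0.
have -> : f x = f (psi t).
  rewrite xE (lattice_period (rho := fun=> 0) pf0 n (psiH t)) big1 ?addr0//.
  by move=> i _; rewrite mulr0.
have fr (r : R) : r - (Num.floor r)%:~R \in `[0, 1].
  rewrite in_itv /= subr_ge0 floor_le_tmp lerBlDl.
  by rewrite -[_ + 1]/(_ + 1%:~R) -intrD ltW// floorD1_gt.
have tK : t \in K by rewrite inE /K /=; split; [split|]; exact: fr.
by rewrite fm // fM.
Qed.

Section Kaehler.
Variables (h omega : tensor2 R) (theta : tensor1 R) (kappa : C2 R -> R) (c : R).
Hypotheses (metric_h : hermitian_metric G h)
  (omegaE : forall x, HxC x -> forall u v, omega x u v = fundamental_form h x u v)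
  (lee_theta : lee_form G omega theta)
  (kappa_gt0 : forall x, HxC x -> 0 < kappa x)
  (kappa_diff : forall x, HxC x -> differentiable kappa x)
  (kappa_derive : forall x v, HxC x -> 'D_v kappa x = - theta x v * kappa x)
  (kappa_period : forall i x, HxC x -> kappa (period i + x) = kappa x)
  (c_gt0 : 0 < c) (kappa_dil : forall x, HxC x -> kappa (dil x) = c * kappa x).

(* The metric h rescaled by kappa; it is Kaehler on the half space. *)
Let hk u v : C2 R -> R := fun x => kappa x * h x u v.

Let h_smooth u v : smooth_on (@HxC R) (fun x => h x u v).
Proof. by have [H _ _] := metric_h; exact: H. Qed.

Let h_diff u v x : HxC x -> differentiable (fun x => h x u v) x.
Proof. by move=> Hx; exact: (smooth_differentiable (h_smooth u v) Hx). Qed.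

Let hk_diff u v x : HxC x -> differentiable (hk u v) x.
Proof. by move=> Hx; apply: differentiableM; [exact: kappa_diff|exact: h_diff]. Qed.

Let hk_derive u v w x : HxC x -> 'D_w (hk u v) x =
  kappa x * ('D_w (fun x => h x u v) x - theta x w * h x u v).
Proof.
move=> Hx; rewrite deriveM; [|apply: diff_derivable..].
- by rewrite kappa_derive// /GRing.scale /=; ring.
- exact: kappa_diff.
- exact: h_diff.
Qed.

Let hk_C1 u v : C1_on (@HxC R) (hk u v).
Proof.
have kc : cont_on (@HxC R) kappa.
  by move=> x Hx; exact: (differentiable_continuous (kappa_diff Hx)).
move=> x Hx; split; first exact: (differentiable_continuous (hk_diff u v Hx)).
move=> w; split; first by apply: diff_derivable; exact: hk_diff.
suff : cont_on (@HxC R) ('D_w (hk u v)) by exact.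
apply: (eq_cont_on (@open_HxC R) (f := fun x => kappa x *
  ('D_w (fun x => h x u v) x - theta x w * h x u v))).
  by move=> y Hy; rewrite hk_derive.
have hC := smooth_C1 (h_smooth u v).
have [[[ts _ _] _] _] := lee_theta.
move=> y Hy; apply: cvgM; first exact: kc.
apply: cvgB; first exact: (C1_derive hC Hy).
by apply: cvgM; [exact: (C1_cont (smooth_C1 (ts w)) Hy)|exact: (C1_cont hC Hy)].
Qed.

Let h_opp u v x : HxC x -> h x u (- v) = - h x u v.
Proof.
move=> Hx; have [_ /(_ x Hx)[lin sym _ _] _] := metric_h.
have z : h x 0 u = 0.
  have := lin 1 0 0 u; rewrite scale1r addr0 mul1r => /esym/eqP.
  by rewrite -subr_eq0 addrK => /eqP.
by rewrite sym -[- v]addr0 -scaleN1r lin z addr0 mulN1r sym.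
Qed.

Let hk_period u v i x : HxC x -> hk u v (period i + x) = hk u v x.
Proof.
move=> Hx; have [_ _ inv] := metric_h.
have := inv _ (G_phi alpha beta a b i) x Hx u v.
by rewrite !derive_phi phiE /hk => ->; rewrite kappa_period.
Qed.

(* Since d kappa = - theta kappa, the form kappa * omega is closed; this is its
   closedness on e_w2, e_z1, e_z2, where omega (e_z1, e_z2) = - h (e_z1, e_z1). *)
Let hk_divergence x : HxC x -> 'D_(e_w2 R) (hk (e_z1 R) (e_z1 R)) x =
  'D_(e_z1 R) (hk (e_w2 R) (e_z1 R)) x + 'D_(e_z2 R) (hk (e_w2 R) (e_z2 R)) x.
Proof.
move=> Hx; have [_ lee] := lee_theta.
have := lee x Hx (e_w2 R) (e_z1 R) (e_z2 R); rewrite /ext_d2 /wedge12.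
have oE y u v w : HxC y -> Jmul v = w -> omega y u v = h y u w.
  by move=> Hy Jv; rewrite omegaE// /fundamental_form Jv.
have o34 y : HxC y -> omega y (e_z1 R) (e_z2 R) = - h y (e_z1 R) (e_z1 R).
  by move=> Hy; rewrite (oE _ _ _ _ Hy (Jmul_z2 R)) h_opp.
have o24 y : HxC y -> omega y (e_w2 R) (e_z2 R) = - h y (e_w2 R) (e_z1 R).
  by move=> Hy; rewrite (oE _ _ _ _ Hy (Jmul_z2 R)) h_opp.
have o23 y : HxC y -> omega y (e_w2 R) (e_z1 R) = h y (e_w2 R) (e_z2 R).
  by move=> Hy; rewrite (oE _ _ _ _ Hy (Jmul_z1 R)).
have oH := @open_HxC R.
rewrite (near_eq_derive (e_w2 R) (near_eq_on oH o34 Hx)).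
rewrite (near_eq_derive (e_z1 R) (near_eq_on oH o24 Hx)).
rewrite (near_eq_derive (e_z2 R) (near_eq_on oH o23 Hx)).
rewrite o34// o24// o23// !deriveN; [|apply: diff_derivable; exact: h_diff..].
rewrite !hk_derive// => e; rewrite -mulrDr; congr (_ * _).
move: e; set A := 'D_(e_w2 R) _ x; set B := 'D_(e_z1 R) _ x; set C := 'D_(e_z2 R) _ x.
by move=> e; lra.
Qed.

(* The dilation scales the z-line by beta, so invariance of h divides
   h (e_z1, e_z1) by the squared norm of beta, that is, multiplies it by alpha. *)
Let hk_dil x : HxC x ->
  hk (e_z1 R) (e_z1 R) (dil x) = c * alpha * hk (e_z1 R) (e_z1 R) x.
Proof.
move=> Hx; have [_ hx inv] := metric_h.
have Hd : HxC (dil x) by exact/HxC_dil.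
have [lin sym _ Jinv] := hx _ Hd.
have := inv _ (G_dil alpha beta a b) x Hx (e_z1 R) (e_z1 R).
rewrite !derive_dil.
have -> : dil (e_z1 R) = complex.Re beta *: e_z1 R + complex.Im beta *: e_z2 R.
  rewrite dil_coord /e_z1 /e_z2 /=.
  by congr ((_, _), (_, _)); rewrite /= /GRing.scale /=; ring.
have h44 : h (dil x) (e_z2 R) (e_z2 R) = h (dil x) (e_z1 R) (e_z1 R).
  by rewrite -Jmul_z1 Jinv.
have h34 : h (dil x) (e_z1 R) (e_z2 R) = 0.
  have := Jinv (e_z1 R) (e_z2 R); rewrite Jmul_z2 Jmul_z1 h_opp// sym => e.
  lra.
have lin' k u v w : h (dil x) w (k *: u + v) = k * h (dil x) w u + h (dil x) w v.
  by rewrite sym lin sym [h _ v w]sym.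
have z u : h (dil x) 0 u = 0.
  have := lin 1 0 0 u; rewrite scale1r addr0 mul1r => /esym/eqP.
  by rewrite -subr_eq0 addrK => /eqP.
have linZ k u v : h (dil x) (k *: u) v = k * h (dil x) u v.
  by rewrite -[k *: u]addr0 lin z addr0.
have linZr k u v : h (dil x) v (k *: u) = k * h (dil x) v u by rewrite sym linZ sym.
rewrite lin !lin' !linZ !linZr [h _ (e_z2 R) (e_z1 R)]sym h34 h44 => e.
have prod := eigen_product detM beta_nonreal a_neq0 b_neq0 a_eigen b_eigen.
rewrite /hk kappa_dil// -e; set X := h _ _ _.
transitivity (c * kappa x * X *
  (alpha * (complex.Re beta ^+ 2 + complex.Im beta ^+ 2))); last by ring.
by rewrite prod mulr1.
Qed.

Let f := hk (e_z1 R) (e_z1 R).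

Let f_gt0 x : HxC x -> 0 < f x.
Proof.
move=> Hx; rewrite /f /hk mulr_gt0 ?kappa_gt0//.
have [_ /(_ x Hx)[_ _ pos _] _] := metric_h; apply: pos.
by apply/eqP => -[] /eqP; rewrite oner_eq0.
Qed.

(* Every slice w_2 = alpha ^+ n is the image of the slice w_2 = 1 under the n-th
   power of the dilation. *)
Let slice_bounds m m' n x : (forall y, y.1.2 = 1 -> m <= f y <= m') ->
  x.1.2 = alpha ^+ n -> (c * alpha) ^+ n * m <= f x <= (c * alpha) ^+ n * m'.
Proof.
move=> fm; elim: n x => [|n IH] x xn; first by rewrite !mul1r fm.
have alpha0 : 0 < alpha by exact: lt_trans alpha_gt1.
have xE := dil_invK alpha_gt1 beta_nonreal x; set y := dil_inv alpha beta x in xE.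
have yn : y.1.2 = alpha ^+ n.
  apply: (mulfI (x := alpha)); first by rewrite gt_eqF.
  by rewrite -exprS -xn -[in RHS]xE dil_coord.
have Hy : HxC y by have := exprn_gt0 n alpha0; rewrite -yn.
have ca0 : 0 < c * alpha by rewrite mulr_gt0.
rewrite -xE /f hk_dil// -/f exprS -(mulrA _ _ m) -(mulrA _ _ m').
by rewrite !(ler_pM2l ca0); exact: IH.
Qed.

(** All Kaehler metrics on the half space obtained from l.c.k. structures have
    the same homothety factor [alpha^-1] under the dilation. The torus mean of
    [kappa * h (e_z1, e_z1)] does not depend on [w_2], by closedness and Stokes'
    theorem on the torus, whereas on the slice [w_2 = alpha ^+ n] it is
    comparable to [(c * alpha) ^+ n]. *)
Lemma kaehler_factor : c * alpha = 1.
Proof.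
have alpha0 : 0 < alpha by exact: lt_trans alpha_gt1.
have ca0 : 0 < c * alpha by rewrite mulr_gt0.
have oH := @open_HxC R; have fC : C1_on (@HxC R) f by exact: hk_C1.
have [m [m' [m0 fm]]] : exists m m' : R, 0 < m /\ forall x, x.1.2 = 1 -> m <= f x <= m'.
  by apply: torus_bounds (C1_cont fC) _ f_gt0 => i x; exact: hk_period.
pose s := [seq period i | i <- enum 'I_3].
have per_s i : period i \in s by apply/map_f; rewrite mem_enum.
have ss : {in s, forall l, stable (@HxC R) l}.
  by move=> l /mapP[i _ ->]; exact: period_stable.
pose F := avgs s f; pose pt (r : R) : C2 R := ((0, r), (0, 0)).
have F_bounds n : (c * alpha) ^+ n * m <= F (pt (alpha ^+ n)) <= (c * alpha) ^+ n * m'.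
  apply: (avgs_bounded oH (P := [set x | x.1.2 = alpha ^+ n])) => //.
  - exact: C1_cont fC.
  - by rewrite /HxC /= exprn_gt0.
  - by move=> l /mapP[i _ ->] y t /= <-; rewrite /GRing.scale /=; ring.
  - by move=> y _ yn; exact: slice_bounds.
have F_cst n : F (pt (alpha ^+ n)) = F (pt 1).
  pose k := alpha ^+ n - 1.
  have [d1 d1E] := periods_span beta_nonreal a_neq0 b_neq0 a_eigen b_eigen 0 1.
  have [d2 d2E] := periods_span beta_nonreal a_neq0 b_neq0 a_eigen b_eigen 0 'i%C.
  rewrite -[LHS]/(F ((0, alpha ^+ n), (0, 0))).
  (* Decomposing e_z1 and e_z2 along the periods writes the right-hand side of
     the divergence identity as a sum of derivatives along periods. *)
  pose g i : C2 R -> R := fun x =>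
    k * d1 i * hk (e_w2 R) (e_z1 R) x + k * d2 i * hk (e_w2 R) (e_z2 R) x.
  have gC i : C1_on (@HxC R) (g i).
    by apply: (C1_on_lincomb oH); exact: hk_C1.
  have gp i x : HxC x -> g i (period i + x) = g i x.
    by move=> Hx; rewrite /g !hk_period.
  have DF x : HxC x -> 'D_(k *: e_w2 R) F x = 0.
    move=> Hx; rewrite (derive_avgs oH _ ss fC Hx).
    rewrite -(avgs_sum_derive oH per_s ss gC gp Hx).
    apply: (eq_avgs ss _ Hx) => y Hy.
    have E1 : 'D_(k *: e_w2 R) f y = k * 'D_(e_w2 R) f y.
      by rewrite !deriveE ?linearZ//; exact: hk_diff.
    have zE (e e' : C2 R) (d : 'I_3 -> R) : e = \sum_i d i *: period i ->
        'D_e (hk (e_w2 R) e') y = \sum_i d i * 'D_(period i) (hk (e_w2 R) e') y.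
      by move=> ->; apply: derive_sum_dir; exact: hk_diff.
    rewrite E1 hk_divergence// (zE _ _ d1 d1E) (zE _ _ d2 d2E).
    rewrite mulrDr !mulr_sumr -big_split; apply: eq_bigr => i _ /=.
    have dh u v : derivable (hk u v) y (period i) by exact: (C1_derivable (hk_C1 u v)).
    have [_ ->] := is_derive_lincomb (k * d1 i) (k * d2 i) (dh (e_w2 R) (e_z1 R))
      (dh (e_w2 R) (e_z2 R)).
    by rewrite !mulrA.
  have FC : C1_on (@HxC R) F by exact: (avgs_C1 oH ss fC).
  have ptE : pt (alpha ^+ n) = k *: e_w2 R + pt 1.
    by congr ((_, _), (_, _)); rewrite /= /GRing.scale /k /=; ring.
  have seg (r : R) : r \in `[0, 1] -> HxC (r *: (k *: e_w2 R) + pt 1).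
    rewrite in_itv /= => /andP[r0 r1]; rewrite /HxC /= /GRing.scale /= mulr1 /k.
    have : 1 <= alpha ^+ n by rewrite exprn_ege1// ltW.
    by move=> an; have := mulr_ge0 r0 (_ : 0 <= alpha ^+ n - 1); nra.
  have [r r01|r r01] := @MVT_line R _ F (pt 1) (k *: e_w2 R).
    by exact: (C1_derivable FC (seg r r01)).
  by rewrite -ptE (DF _ (seg _ r01)) => /eqP; rewrite subr_eq0 => /eqP.
have F0 := F_bounds 0%N; rewrite expr0 !mul1r in F0; have [F0m F0m'] := andP F0.
have Fp : 0 < F (pt 1) by exact: lt_le_trans F0m.
apply/eqP; rewrite eq_le; apply/andP; split.
  apply: (@expr_bounded_le1 _ _ (F (pt 1) / m)) => // n.
  by rewrite ler_pdivlMr//; have /andP[] := F_bounds n; rewrite F_cst.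
rewrite -invf_le1//; apply: (@expr_bounded_le1 _ _ (m' / F (pt 1))).
  by rewrite invr_gt0.
move=> n; rewrite exprVn ler_pdivlMr// mulrC ler_pdivrMr ?exprn_gt0// mulrC.
by have /andP[] := F_bounds n; rewrite F_cst.
Qed.
End Kaehler.
End Factor.

(** * Periods of closed forms and the theorem *)

Section ClosedForms.
Context (R : realType) (M : 'M[int]_3) (alpha : R) (beta : R[i])
  (a : 'cV[R]_3) (b : 'cV[R[i]]_3).
Hypotheses (alpha_gt1 : 1 < alpha)
  (beta_nonreal : beta != conjc beta) (a_neq0 : a != 0) (b_neq0 : b != 0)
  (a_eigen : map_mx intr M *m a = alpha *: a)
  (b_eigen : map_mx intr M *m b = beta *: b).
Local Notation G := (inoue_group alpha beta a b).
Local Notation dil := (phi0 alpha beta).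
Local Notation period := (period a b).
Variable eta : tensor1 R.
Hypothesis eta_closed : closed_form1 G eta.
Implicit Types (x y v : C2 R).

Let E := primitive (e_w2 R) eta.

Let HxC_base : HxC (e_w2 R).
Proof. exact: ltr01. Qed.

Lemma is_derive_half_space_primitive x v : HxC x -> is_derive x v E (eta x v).
Proof.
have [[sm lin _] cl] := eta_closed.
apply: (is_derive_primitive (@open_HxC R)) => // y t Hy t01.
exact: HxC_segment.
Qed.

Lemma half_space_primitive_smooth : smooth_on (@HxC R) E.
Proof.
have [[sm lin _] cl] := eta_closed.
apply: (primitive_smooth (@open_HxC R)) => // y t Hy t01.
exact: HxC_segment.
Qed.

(** The increment of a primitive under a group element has derivative zero, by
    invariance of the form. *)
Lemma primitive_shift (p l : C2 R -> C2 R) : G p ->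
  (forall x, HxC x -> HxC (p x)) ->
  (forall (h : R) v x, p (h *: v + x) = h *: l v + p x) ->
  exists rho : R, forall x, HxC x -> E (p x) = E x + rho.
Proof.
move=> Gp Hp pE; exists (E (p (e_w2 R)) - E (e_w2 R)) => x Hx.
suff -> : E (p (e_w2 R)) - E (e_w2 R) = E (p x) - E x by rewrite addrC subrK.
apply: (HxC_constant (g := (E \o p) - E)) => // y v Hy.
have [[_ _ inv] _] := eta_closed.
have [e d] := derive_affine E (pE^~ v^~ y).
have [d1 d2] := is_derive_half_space_primitive (l v) (Hp _ Hy).
have Dp : 'D_v p y = l v by exact: derive_affine_map (pE^~ v^~ y).
have dEp : is_derive y v (E \o p) (eta y v).
  by split; [exact: d|rewrite e d2 -(inv p Gp y Hy v) Dp].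
by have := is_deriveB dEp (is_derive_half_space_primitive v Hy); rewrite subrr.
Qed.

(** A translation and its conjugate by the dilation have the same period, and the
    dilation acts on translations through [M]; hence the periods of the
    translations form a fixed vector of [M], which vanishes. This is the equality
    [b_1 = 1] for the quotient surface. *)
Lemma primitive_periods : exists rho : R, [/\
  forall i x, HxC x -> E (period i + x) = E x &
  forall x, HxC x -> E (dil x) = E x + rho].
Proof.
have trans i : exists r : R, forall x, HxC x -> E (phi a b i x) = E x + r.
  apply: (primitive_shift (l := id)) (G_phi alpha beta a b i) _ _.
    by move=> x Hx; exact/HxC_phi.
  by move=> h v x; rewrite !phiE addrCA.
have [r rE] := choice trans.
have [rho rhoE] : exists rho : R, forall x, HxC x -> E (dil x) = E x + rho.
  apply: (primitive_shift (l := dil)) (G_dil alpha beta a b) _ _.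
    by move=> x Hx; exact/HxC_dil.
  exact: dil_linear.
have rE' i x : HxC x -> E (period i + x) = E x + r i by move=> Hx; rewrite -phiE rE.
have Mr : map_mx intr M *m (\col_i r i) = \col_i r i.
  apply/matrixP => i j; rewrite !mxE.
  transitivity (\sum_k (M i k)%:~R * r k); first by apply: eq_bigr => k _; rewrite !mxE.
  have Hd : HxC (dil (e_w2 R)) by exact/HxC_dil.
  have := lattice_period rE' (M i) Hd.
  rewrite -(dil_period a_eigen b_eigen) -[dil (period i)]scale1r.
  have -> : 1 *: dil (period i) + dil (e_w2 R) = dil (period i + e_w2 R).
    by rewrite -dil_linear scale1r.
  rewrite !rhoE//; last by rewrite /HxC /= add0r ltr01.
  by rewrite rE'// => e; lra.
have r0 := fixed_vector_eq0 alpha_gt1 beta_nonreal a_neq0 b_neq0 a_eigen b_eigen Mr.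
exists rho; split=> // i x Hx; rewrite rE'//.
have := congr1 (fun A : 'cV_3 => A i ord0) r0; rewrite !mxE => ->.
by rewrite addr0.
Qed.

Lemma invariant_primitive_exact :
  (forall i x, HxC x -> E (period i + x) = E x) ->
  (forall x, HxC x -> E (dil x) = E x) -> exact_form1 G eta.
Proof.
move=> Ep Ed.
have inv g : G g -> forall x, (HxC (g x) <-> HxC x) /\ (HxC x -> E (g x) = E x).
  elim=> {g} [g|x|f g _ IHf _ IHg x|f g _ IHf fK gK x].
  - case=> [-> x|[i ->] x]; first by split; [exact: HxC_dil|exact: Ed].
    by split; [exact: HxC_phi|rewrite phiE; exact: Ep].
  - by [].
  - have [f1 f2] := IHf (g x); have [g1 g2] := IHg x; split; first exact: iff_trans g1.
    by move=> Hx; rewrite /= f2 ?g2//; exact/g1.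
  - have [f1 f2] := IHf (g x); rewrite gK in f1 f2; split; first by split=> /f1.
    by move=> Hx; rewrite f2//; exact/f1.
(* The primitive descends to orbits; on an orbit it is evaluated at some point
   of the half space. *)
pose F (p : set (C2 R)) : R := E (get (p `&` @HxC R)).
have FE x : HxC x -> F (orbit_of G x) = E x.
  move=> Hx; rewrite /F.
  have : (orbit_of G x `&` @HxC R) (get (orbit_of G x `&` @HxC R)).
    by apply: getPex; exists x; split=> //; exists id => //; exact: gen_id.
  move=> [[g Gg ->] _]; exact: (inv g Gg x).2.
have oH := @open_HxC R.
exists F.
  rewrite /quot_smooth; have -> : @HxC R `&` orbit_of G @^-1` quot G = @HxC R.
    by apply/seteqP; split=> [x []//|x Hx]; split=> //; exact: quot_orbit.
  apply: (eq_smooth_on oH (f := E)) => [y Hy|]; first by rewrite /= FE.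
  exact: half_space_primitive_smooth.
move=> x Hx v; rewrite /quot_d.
have FE' y : HxC y -> (F \o orbit_of G) y = E y by exact: FE.
rewrite (near_eq_derive v (near_eq_on oH FE' Hx)).
by have [_ ->] := is_derive_half_space_primitive v Hx.
Qed.

End ClosedForms.

Theorem proposition7p5 (R : realType) (M : 'M[int]_3)
  (alpha : R) (beta : R[i]) (a : 'cV[R]_3) (b : 'cV[R[i]]_3)
  (detM : \det M = 1)
  (alpha_gt1 : 1 < alpha)
  (beta_nonreal : beta != conjc beta)
  (a_neq0 : a != 0) (b_neq0 : b != 0)
  (a_eigen : map_mx intr M *m a = alpha *: a)
  (b_eigen : map_mx intr M *m b = beta *: b)
  (L : bundle R) (eta : tensor1 R) (Ls : R -> bundle R) :
  let G := inoue_group alpha beta a b in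
  flat_bundle G L ->
  corresponding_bundle G (@inoue_omega R) L ->
  closed_form1 G eta ->
  ~ exact_form1 G eta ->
  (forall s : R, deformation G L (fun x v => s * eta x v) (Ls s)) ->
  flat_iso G (Ls 0) L ->
  ~ exists2 eps : R, 0 < eps &
      exists2 omegas : R -> tensor2 R, smooth_family eps omegas &
        forall s : R, `|s| < eps ->
          lck G (omegas s) /\ corresponding_bundle G (omegas s) (Ls s).
Proof.
move=> G fL [theta [lee [I [U [f [oU sf df _ [r iso_r lc_r]]]]]]] ceta nex defo _.
move=> [eps eps0 [omegas _ lcks]].
(* One nonzero parameter is enough for the contradiction. *)
pose s := eps / 2; have s0 : 0 < s by rewrite divr_gt0.
have seps : `|s| < eps by rewrite ger0_norm ?ltW// /s; lra.
have [[[h mh ohE] _]] := lcks s seps.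
move=> [theta' [lee' [I' [U' [f' [oU' sf' df' _ [r' iso_r' lc_r']]]]]]].
have [fL' [t [iso_t st tw]]] := defo s.
have ct k a' x v := @iso_twisted_closed R G L (Ls s) _ t fL' iso_t st tw k a' x v.
have [oL _ _ _] := fL; have [oL' _ _ _] := fL'.
have [k0 k0_gt0 k0D] := ratio_potential oL oL' oU oU' iso_t st ct sf sf' df df'
  iso_r iso_r' lc_r lc_r'.
have [rho [Ep Ed]] := primitive_periods alpha_gt1 beta_nonreal a_neq0 b_neq0
  a_eigen b_eigen ceta.
set E := primitive (e_w2 R) eta in Ep Ed.
(* The factors of kappa have logarithmic derivatives theta - theta' - s * eta,
   s * eta and - theta, where theta = dw_2 / w_2; the sum is - theta'. *)
pose kappa x := k0 (orbit_of G x) * expR (s * E x) / x.1.2.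
suff rho0 : rho = 0.
  apply: nex; apply: (invariant_primitive_exact (alpha := alpha)) => //.
  by move=> x Hx; rewrite -/E Ed// rho0 addr0.
have dE x : HxC x -> differentiable E x.
  by move=> Hx; exact: (smooth_differentiable (half_space_primitive_smooth ceta) Hx).
have cw : continuous (fun x : C2 R => x.1.2).
  exact: (@coord_continuous R (Ordinal (isT : (1 < 4)%N))).
have dw x : differentiable (fun x : C2 R => x.1.2) x.
  exact: (@coord_differentiable R (Ordinal (isT : (1 < 4)%N))).
have Dw x v : 'D_v (fun x : C2 R => x.1.2) x = v.1.2.
  exact: (@derive_coord R (Ordinal (isT : (1 < 4)%N))).
have kP x : HxC x -> differentiable kappa x /\
    forall v, 'D_v kappa x = - theta' x v * kappa x.
  move=> Hx; have x0 : x.1.2 != 0 by rewrite gt_eqF.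
  have [dk Dk] := k0D x Hx.
  have dsE : differentiable (fun x => s * E x) x by exact: (differentiableZ s (dE x Hx)).
  have [de _] := derive_expR_comp 0 dsE.
  have dwV : differentiable (fun x : C2 R => x.1.2^-1) x by exact: differentiableV.
  have d2 := differentiableM dk de; have d3 := differentiableM d2 dwV.
  split=> [|v]; first exact: d3.
  have D3 := deriveM (diff_derivable (v := v) d2) (diff_derivable (v := v) dwV).
  rewrite [LHS]D3 deriveM; [|exact: diff_derivable..].
  have [_ ->] := derive_expR_comp v dsE.
  have -> : 'D_v (fun x => s * E x) x = s * eta x v.
    have [_ De] := is_derive_half_space_primitive ceta v Hx.
    by rewrite -De; exact: (deriveZ s (diff_derivable (v := v) (dE x Hx))).
  rewrite deriveV//; last exact: diff_derivable.
  rewrite Dw Dk (lee_form_inoue v lee Hx) /kappa !fctE /GRing.scale /=; field.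
  exact: x0.
have kgt0 x : HxC x -> 0 < kappa x.
  by move=> Hx; rewrite /kappa !mulr_gt0 ?invr_gt0 ?expR_gt0 ?k0_gt0.
have kper i x : HxC x -> kappa (period a b i + x) = kappa x.
  move=> Hx; rewrite /kappa Ep// -phiE orbit_phi; congr (_ / _).
  by rewrite phiE /= add0r.
have kdil x : HxC x -> kappa (phi0 alpha beta x) = expR (s * rho) / alpha * kappa x.
  move=> Hx; rewrite /kappa Ed// orbit_dil// mulrDr expRD dil_coord /=.
  by rewrite invfM; ring.
have c0 : 0 < expR (s * rho) / alpha.
  by rewrite divr_gt0 ?expR_gt0// (lt_trans ltr01).
have := kaehler_factor detM alpha_gt1 beta_nonreal a_neq0 b_neq0 a_eigen b_eigen
  mh ohE lee' kgt0 (fun x Hx => (kP x Hx).1) (fun x v Hx => (kP x Hx).2 v) kper c0 kdil.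
rewrite divfK; last by rewrite gt_eqF// (lt_trans ltr01).
move=> /(congr1 (@ln R)); rewrite expRK ln1 => /eqP; rewrite mulf_eq0 gt_eqF//=.
by move/eqP.
Qed.
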